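(* Let $p\in[1,\infty]$ have conjugate index $q$, and let $n\in\mathbb N$. Then: (i) for $p\in[1,2]$, we have $\varphi_n^{\max}(\ell^p)=\varphi_n^{\max}(\ell_n^p)=n^{1/p}$; (ii) for $p\in[2,\infty]$, we have $\sqrt n\le\varphi_n^{\max}(\ell_n^p)\le\varphi_n^{\max}(\ell^p)\le C_q\sqrt n$, where $C_q$ is the Orlicz constant of $\ell^q$.
   Context: $\ell^p=\ell^p(\mathbb N)$ and $\ell_n^p=(\mathbb C^n,\|\cdot\|_p)$ are the usual complex spaces; $1/p+1/q=1$ (with $1,\infty$ conjugate). A multi-norm based on a complex normed space $(E,\|\cdot\|)$ is a sequence $(\|\cdot\|_k:k\in\mathbb N)$, with $\|\cdot\|_k$ a norm on $E^k$ and $\|x\|_1=\|x\|$, such that for each $k\ge2$: (A1) $\|(x_{\sigma(1)},\dots,x_{\sigma(k)})\|_k=\|(x_1,\dots,x_k)\|_k$ for each permutation $\sigma$ of $\{1,\dots,k\}$; (A2) $\|(\alpha_1x_1,\dots,\alpha_kx_k)\|_k\le(\max_i|\alpha_i|)\|(x_1,\dots,x_k)\|_k$ for $\alpha_i\in\mathbb C$; (A3) $\|(x_1,\dots,x_{k-1},0)\|_k=\|(x_1,\dots,x_{k-1})\|_{k-1}$; (A4) $\|(x_1,\dots,x_{k-2},x_{k-1},x_{k-1})\|_k=\|(x_1,\dots,x_{k-1})\|_{k-1}$, for all $x_i\in E$. The maximum multi-norm $(\|\cdot\|_n^{\max})$ based on $E$ is the pointwise supremum of all multi-norms based on $E$ (it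 is itself a multi-norm), and $\varphi_n^{\max}(E)=\sup\{\|(x_1,\dots,x_n)\|_n^{\max}:x_i\in E,\ \|x_i\|\le1\}$. For $q\in[1,2]$, the Orlicz constant $C_q$ of $F=\ell^q$ is $C_q=\sup\{(\sum_{j=1}^m\|x_j\|^2)^{1/2}:m\in\mathbb N,\ x_1,\dots,x_m\in F,\ \mu_{1,m}(x_1,\dots,x_m)\le1\}$, where $\mu_{1,m}(x_1,\dots,x_m)=\sup\{\sum_{j=1}^m|\langle x_j,\lambda\rangle|:\lambda\in F',\|\lambda\|\le1\}$; it is finite, since $\ell^q$ has the Orlicz property for $q\in[1,2]$. *)

(* Defs.v *)
From HB Require Import structures.
From mathcomp Require Import all_boot all_order all_algebra all_fingroup.
From mathcomp Require Import complex.
From mathcomp Require Import all_classical all_reals all_analysis.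

Set Implicit Arguments.
Unset Strict Implicit.
Unset Printing Implicit Defensive.
Import Order.TTheory GRing.Theory Num.Theory.
Import numFieldNormedType.Exports.

Local Open Scope classical_set_scope.
Local Open Scope ring_scope.

(* The library norm of a complex normed space takes its (real nonnegative)
   values in R[i]; rnorm is the same norm with values in R. *)
Definition rnorm (R : realType) (V : normedZmodType R[i]) (x : V) : R :=
  complex.Re `|x|.

Section RnormTheory.
Context {R : realType} {V : normedZmodType R[i]}.
Implicit Types x y : V.

Lemma rnormE x : `|x| = (rnorm x)%:C%C.
Proof.
rewrite /rnorm; have := normr_ge0 x; case: `|x| => a b.
by rewrite lecE /= => /andP[/eqP -> _].
Qed.

Lemma rnorm_ge0 x : 0 <= rnorm x.
Proof. by have := normr_ge0 x; rewrite rnormE ler0c. Qed.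

Lemma rnormD x y : rnorm (x + y) <= rnorm x + rnorm y.
Proof. by have := ler_normD x y; rewrite !rnormE -rmorphD lecR. Qed.

Lemma rnorm_eq0 x : rnorm x = 0 -> x = 0.
Proof. by move=> x0; apply/normr0_eq0; rewrite rnormE x0. Qed.

Lemma rnorm0 : rnorm (0 : V) = 0.
Proof. by rewrite /rnorm normr0. Qed.

End RnormTheory.

Lemma rnormM (R : realType) (a b : R[i]) : rnorm (a * b) = rnorm a * rnorm b.
Proof.
by apply: (@complexI R); rewrite rmorphM /= -!rnormE normrM.
Qed.

(* [lpnorm p x] is the l^p-norm, in [0, +oo], of a family x of complex numbers;
   it is only meaningful for 1 <= p. *)
Definition lpnorm (R : realType) (I : choiceType) (p : \bar R) (x : I -> R[i]) :
    \bar R :=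
  if p is r%:E then
    ((\esum_(i in [set: I]) (rnorm (x i) `^ r)%:E) `^ r^-1)%E
  else ereal_sup [set (rnorm (x i))%:E | i in [set: I]].

Section LpnormTheory.
Context {R : realType} {I : choiceType}.
Implicit Types (p : \bar R) (x y : I -> R[i]).

Lemma lpnorm_finP p x (c : R) : (1 <= p)%E -> 0 <= c ->
  (lpnorm p x <= c%:E)%E =
  if p is r%:E then (\esum_(i in [set: I]) (rnorm (x i) `^ r)%:E <= (c `^ r)%:E)%E
  else `[< forall i, rnorm (x i) <= c >].
Proof.
case: p => [r| |] //= p1 c0.
- rewrite lee_fin in p1; have r0 : 0 < r by exact: lt_le_trans p1.
  set S := (\esum_(i in _) _)%E.
  have S0 : (0 <= S)%E by apply: esum_ge0 => i _; rewrite lee_fin powR_ge0.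
  apply/idP/idP => h.
  + have := @gt0_ler_poweR R r (ltW r0) _ _ _ _ h.
    rewrite poweR_EFin -poweRrM mulVf ?gt_eqF// poweRe1//; apply.
    * by rewrite in_itv/= leey poweR_ge0.
    * by rewrite in_itv/= leey lee_fin c0.
  + have := @gt0_ler_poweR R r^-1 _ _ _ _ _ h.
    rewrite poweR_EFin -powRrM mulfV ?gt_eqF// powRr1//; apply.
    * by rewrite invr_ge0 ltW.
    * by rewrite in_itv/= leey S0.
    * by rewrite in_itv/= leey lee_fin powR_ge0.
- apply/idP/asboolP => h.
  + move=> i; rewrite -lee_fin; apply: le_trans h.
    by apply: ereal_sup_ubound; exists i.
  + by apply: ge_ereal_sup => _ [i _ <-]; rewrite lee_fin.
Qed.

Lemma esum_scale_le (c : R) (f : I -> R) : 0 <= c -> (forall i, 0 <= f i) ->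
  (\esum_(i in [set: I]) (c * f i)%:E <=
   c%:E * \esum_(i in [set: I]) (f i)%:E)%E.
Proof.
move=> c0 f0; apply: ge_ereal_sup => _ [X [finX _] <-].
under eq_fsbigr do rewrite EFinM.
rewrite -ge0_mule_fsumr; last by move=> i; rewrite lee_fin.
by apply: lee_wpmul2l; [rewrite lee_fin|apply: ereal_sup_ubound; exists X].
Qed.

Lemma powR_conv_le (r a b u v : R) :
  1 <= r -> 0 < a -> 0 < b -> 0 <= u -> 0 <= v ->
  (u + v) `^ r <= (a + b) `^ r * (a / (a + b)) / a `^ r * u `^ r +
                  (a + b) `^ r * (b / (a + b)) / b `^ r * v `^ r.
Proof.
move=> r1 a0 b0 u0 v0; have ab0 : 0 < a + b by exact: addr_gt0.
have s0 : 0 <= a / (a + b) by rewrite divr_ge0 ?ltW.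
have t0 : 0 <= b / (a + b) by rewrite divr_ge0 ?ltW.
have st : b / (a + b) = 1 - a / (a + b).
  rewrite -[X in _ = X - _](@divff _ (a + b)) ?gt_eqF//.
  by rewrite -mulrBl addrAC subrr add0r.
have s1 : a / (a + b) <= 1 by rewrite -subr_ge0 -st.
have aE : a * (u / a) = u by rewrite mulrCA divff ?mulr1// gt_eqF.
have bE : b * (v / b) = v by rewrite mulrCA divff ?mulr1// gt_eqF.
have U0 : 0 <= u / a by apply: divr_ge0 => //; exact: ltW.
have V0 : 0 <= v / b by apply: divr_ge0 => //; exact: ltW.
have dE c d : (a + b) * (c / (a + b) * d) = c * d.
  by rewrite mulrCA mulrA [_ * (a + b)]mulrC mulrCA divff ?mulr1 ?gt_eqF.
have -> : u + v = (a + b) * (a / (a + b) * (u / a) + b / (a + b) * (v / b)).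
  by rewrite mulrDr !dE aE bE.
rewrite powRM ?(ltW ab0)//; last by rewrite addr_ge0// mulr_ge0.
have -> : (a + b) `^ r * (a / (a + b)) / a `^ r * u `^ r =
          (a + b) `^ r * (a / (a + b) * (u / a) `^ r).
  have -> : u `^ r = a `^ r * (u / a) `^ r.
    by rewrite -(powRM _ (ltW a0) U0) aE.
  by rewrite [LHS]mulrA divfK ?mulrA// gt_eqF ?powR_gt0.
have -> : (a + b) `^ r * (b / (a + b)) / b `^ r * v `^ r =
          (a + b) `^ r * (b / (a + b) * (v / b) `^ r).
  have -> : v `^ r = b `^ r * (v / b) `^ r.
    by rewrite -(powRM _ (ltW b0) V0) bE.
  by rewrite [LHS]mulrA divfK ?mulrA// gt_eqF ?powR_gt0.
rewrite -mulrDr; apply: ler_wpM2l; first exact: powR_ge0.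
have := @convex_powR R r r1 (Itv01 s0 s1) (u / a) (v / b).
rewrite !inE /= !in_itv /= !andbT => /(_ U0 V0).
by rewrite st; exact.
Qed.

Lemma lpnorm_leD p x y (a b : R) : (1 <= p)%E -> 0 < a -> 0 < b ->
  (lpnorm p x <= a%:E)%E -> (lpnorm p y <= b%:E)%E ->
  (lpnorm p (x + y)%R <= (a + b)%:E)%E.
Proof.
move=> p1 a0 b0; have ab0 : 0 < a + b by exact: addr_gt0.
rewrite !(lpnorm_finP _ p1 (ltW _))//; case: p p1 => [r| |] //= p1; last first.
  move=> /asboolP hx /asboolP hy; apply/asboolP => i.
  by apply: le_trans (rnormD _ _) _; exact: lerD.
rewrite lee_fin in p1; have r0 : 0 < r by exact: lt_le_trans p1.
move=> hx hy.
set cx := (a + b) `^ r * (a / (a + b)) / a `^ r.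
set cy := (a + b) `^ r * (b / (a + b)) / b `^ r.
have cx0 : 0 <= cx.
  by rewrite /cx divr_ge0 ?powR_ge0// mulr_ge0 ?powR_ge0// divr_ge0 ?ltW.
have cy0 : 0 <= cy.
  by rewrite /cy divr_ge0 ?powR_ge0// mulr_ge0 ?powR_ge0// divr_ge0 ?ltW.
have cxy : cx * a `^ r + cy * b `^ r = (a + b) `^ r.
  rewrite /cx /cy !divfK ?gt_eqF ?powR_gt0//.
  by rewrite -mulrDr -mulrDl divff ?mulr1// gt_eqF.
have key i : rnorm ((x + y) i) `^ r <=
    cx * rnorm (x i) `^ r + cy * rnorm (y i) `^ r.
  apply: le_trans (powR_conv_le p1 a0 b0 (rnorm_ge0 _) (rnorm_ge0 _)).
  apply: (ge0_ler_powR (ltW r0)); last exact: rnormD.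
  - by rewrite nnegrE rnorm_ge0.
  - by rewrite nnegrE addr_ge0 ?rnorm_ge0.
clearbody cx cy.
apply: (@le_trans _ _ (cx%:E * (\esum_(i in [set: I]) (rnorm (x i) `^ r)%:E)
   + cy%:E * (\esum_(i in [set: I]) (rnorm (y i) `^ r)%:E))%E).
  apply: le_trans (leeD (esum_scale_le cx0 _) (esum_scale_le cy0 _));
    [|by move=> i; exact: powR_ge0|by move=> i; exact: powR_ge0].
  rewrite -esumD; [|by move=> i _; rewrite lee_fin mulr_ge0 ?powR_ge0..].
  by apply: le_esum => i _; rewrite -EFinD lee_fin; exact: key.
rewrite -cxy EFinD !EFinM; apply: leeD; exact: lee_wpmul2l.
Qed.

Lemma lpnorm_leZ p x (k : R[i]) (a : R) : (1 <= p)%E -> 0 <= a ->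
  (lpnorm p x <= a%:E)%E -> (lpnorm p (k *: x)%R <= (rnorm k * a)%:E)%E.
Proof.
move=> p1 a0; have k0 := rnorm_ge0 k; have ka0 := mulr_ge0 k0 a0.
rewrite (lpnorm_finP _ p1 a0) (lpnorm_finP _ p1 ka0).
case: p p1 => [r| |] //= p1; last first.
  move=> /asboolP hx; apply/asboolP => i.
  by rewrite rnormM ler_wpM2l.
move=> hx; rewrite powRM// EFinM.
under eq_esum do rewrite rnormM (powRM _ k0 (rnorm_ge0 _)).
apply: le_trans (esum_scale_le (powR_ge0 _ _) (fun=> powR_ge0 _ _)) _.
by apply: lee_wpmul2l => //; rewrite lee_fin powR_ge0.
Qed.

Lemma lpnorm_le0 p x : (1 <= p)%E -> (lpnorm p x <= 0)%E -> forall k, x k = 0.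
Proof.
move=> p1 + k; rewrite -[X in (_ <= X)%E]/((0 : R)%:E) lpnorm_finP// => x0.
apply/rnorm_eq0/le_anti; rewrite rnorm_ge0 andbT.
case: p p1 x0 => [r| |] //= p1; last by move/asboolP.
rewrite lee_fin in p1; have r0 : 0 < r by exact: lt_le_trans p1.
rewrite powR0 ?gt_eqF// => x0; rewrite (@powR_eq0_eq0 _ (rnorm (x k)) r)//.
apply/le_anti; rewrite powR_ge0 andbT -lee_fin; apply: le_trans x0.
apply: esum_ge; exists [set k]; first by split => //; exact: finite_set1.
by rewrite fsbig_set1.
Qed.

Lemma lpnorm_ge0 p x : (1 <= p)%E -> 0 <= fine (lpnorm p x).
Proof.
case: p => [r| |] //= _; first exact/fine_ge0/poweR_ge0.
have [[k]|I0] := pselect (inhabited I).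
  apply/fine_ge0/(@le_trans _ _ (rnorm (x k))%:E); rewrite ?lee_fin ?rnorm_ge0//.
  by apply: ereal_sup_ubound; exists k.
rewrite (_ : [set _ | _ in _] = set0) ?ereal_sup0//.
by apply/seteqP; split => // y [k]; case: I0.
Qed.

Lemma lpnorm_le_fine p x :
  (lpnorm p x < +oo)%E -> (lpnorm p x <= (fine (lpnorm p x))%:E)%E.
Proof. by case: (lpnorm p x) => [r| |] //= _; rewrite leNye. Qed.

Lemma fine_lpnorm_le p x (c : R) : 0 <= c ->
  (lpnorm p x <= c%:E)%E -> fine (lpnorm p x) <= c.
Proof. by case: (lpnorm p x) => [r| |] //= c0; rewrite lee_fin. Qed.

End LpnormTheory.

Lemma finite_lpnorm_submod (R : realType) (I : choiceType) (p : \bar R)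
    (p1 : (1 <= p)%E) :
  submod_closed (mem [set x : I -> R[i] | (lpnorm p x < +oo)%E]).
Proof.
split=> [|k x y]; rewrite !inE /=.
  apply: (@le_lt_trans _ _ (0 : R)%:E); last exact: ltry.
  rewrite lpnorm_finP//; case: p p1 => [r| |] //= p1.
    rewrite esum1 ?lee_fin ?powR_ge0// => i _.
    by rewrite rnorm0 powR0// gt_eqF// (lt_le_trans ltr01).
  by apply/asboolP => i; rewrite rnorm0.
move=> xoo yoo.
have N0 z := lpnorm_ge0 (I := I) z p1.
have ltD1 (a : R) : a <= a + 1 by rewrite lerDl.
have gt0D1 (a : R) : 0 <= a -> 0 < a + 1.
  by move=> a0; rewrite (lt_le_trans ltr01)// lerDr.
pose a := rnorm k * fine (lpnorm p x); pose b := fine (lpnorm p y).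
have a0 : 0 <= a by rewrite mulr_ge0 ?rnorm_ge0.
have b0 : 0 <= b by exact: N0.
have hx : (lpnorm p (k *: x)%R <= (a + 1)%:E)%E.
  apply: le_trans (lpnorm_leZ k p1 (N0 x) (lpnorm_le_fine xoo)) _.
  by rewrite lee_fin.
have hy : (lpnorm p y <= (b + 1)%:E)%E.
  by apply: le_trans (lpnorm_le_fine yoo) _; rewrite lee_fin.
apply: le_lt_trans (lpnorm_leD p1 (gt0D1 _ a0) (gt0D1 _ b0) hx hy) _.
exact: ltry.
Qed.

Section Lp.
Context {R : realType} (I : choiceType) {p : \bar R}.

(* p1 is unused: it lets the closure instance below be inferred. *)
Definition finite_lpnorm (p1 : (1 <= p)%E) : {pred I -> R[i]} :=
  mem [set x | (lpnorm p x < +oo)%E].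

HB.instance Definition _ (p1 : (1 <= p)%E) :=
  GRing.isSubmodClosed.Build R[i] (I -> R[i]) (finite_lpnorm p1)
    (finite_lpnorm_submod I p1).

(* l^p(I): the families x : I -> C with finite l^p-norm. *)
Record lp (p1 : (1 <= p)%E) := Lp {
  lp_val :> I -> R[i];
  _ : lp_val \in finite_lpnorm p1 }.

Section LpNormed.
Variable p1 : (1 <= p)%E.

HB.instance Definition _ := [isSub for @lp_val p1].
HB.instance Definition _ := [Choice of lp p1 by <:].
HB.instance Definition _ := [SubChoice_isSubLmodule of lp p1 by <:].

Implicit Types x y : lp p1.

Lemma lp_finite x : (lpnorm p x < +oo)%E.
Proof. by have := valP x; rewrite inE. Qed.

Definition lp_norm x : R[i] := (fine (lpnorm p x))%:C%C.

Let le_lp_normD x y : lp_norm (x + y) <= lp_norm x + lp_norm y.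
Proof.
rewrite /lp_norm -rmorphD lecR; apply/ler_addgt0Pr => e e0.
have e20 : 0 < e / 2 by rewrite divr_gt0.
have N0 z : 0 <= fine (lpnorm p z) := lpnorm_ge0 z p1.
have hx : (lpnorm p x <= (fine (lpnorm p x) + e / 2)%:E)%E.
  by rewrite (le_trans (lpnorm_le_fine (lp_finite x)))// lee_fin lerDl ltW.
have hy : (lpnorm p y <= (fine (lpnorm p y) + e / 2)%:E)%E.
  by rewrite (le_trans (lpnorm_le_fine (lp_finite y)))// lee_fin lerDl ltW.
have xe0 : 0 < fine (lpnorm p x) + e / 2 by rewrite ltr_wpDl.
have ye0 : 0 < fine (lpnorm p y) + e / 2 by rewrite ltr_wpDl.
rewrite (_ : _ + e = (fine (lpnorm p x) + e / 2) + (fine (lpnorm p y) + e / 2));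
  last by rewrite addrACA -splitr.
apply: fine_lpnorm_le.
  by apply: addr_ge0; exact: ltW.
exact: lpnorm_leD.
Qed.

Let lp_norm_leZ (k : R[i]) x : lp_norm (k *: x) <= `|k| * lp_norm x.
Proof.
have N0 : 0 <= fine (lpnorm p x) by exact: lpnorm_ge0.
rewrite rnormE /lp_norm -rmorphM lecR; apply: fine_lpnorm_le.
  by rewrite mulr_ge0 ?rnorm_ge0.
by apply: lpnorm_leZ => //; exact/lpnorm_le_fine/lp_finite.
Qed.

Let lp_normZ (k : R[i]) x : lp_norm (k *: x) = `|k| * lp_norm x.
Proof.
apply/eqP; rewrite eq_le lp_norm_leZ /=.
have [->|k0] := eqVneq k 0.
  by rewrite normr0 mul0r scale0r lecR lpnorm_ge0.
rewrite -{1}[x](scalerK k0) -ler_pdivlMl ?normr_gt0// -normfV.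
exact: lp_norm_leZ.
Qed.

Let lp_norm_eq0 x : lp_norm x = 0 -> x = 0.
Proof.
move=> /complexI x0; apply/val_inj/funext => k.
apply: (lpnorm_le0 p1); rewrite -[leRHS]/((0 : R)%:E) -x0.
exact/lpnorm_le_fine/lp_finite.
Qed.

HB.instance Definition _ :=
  @Lmodule_isNormed.Build R[i] (lp p1) lp_norm le_lp_normD lp_normZ lp_norm_eq0.

Lemma lp_rnormE x : rnorm x = fine (lpnorm p x).
Proof. by []. Qed.

End LpNormed.
End Lp.

(* For a finite index set, l^p(I) consists of all families: lp 'I_n p1 is the
   space C^n with the l^p-norm. *)
Lemma lpnorm_fintype (R : realType) (I : finType) (p : \bar R)
  (x : I -> R[i]) : (1 <= p)%E -> (lpnorm p x < +oo)%E.
Proof.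
case: p => [r| |] //= _.
  apply: poweR_lty; rewrite -[X in esum X]set_mem_set.
  rewrite esum_fset; last by move=> k _; rewrite lee_fin powR_ge0.
    by rewrite fsumEFin ?ltry.
  exact: finite_finset.
apply: (@le_lt_trans _ _ (\sum_k rnorm (x k))%:E); last exact: ltry.
apply: ge_ereal_sup => _ [k _ <-]; rewrite lee_fin (bigD1 k)//= lerDl.
by apply: sumr_ge0 => j _; exact: rnorm_ge0.
Qed.



(* The extension (x_1, ..., x_k, y) of the k-tuple x. *)
Definition fsnoc (E : Type) (k : nat) (x : 'I_k -> E) (y : E) : 'I_k.+1 -> E :=
  fun i => oapp x y (unlift ord_max i).

Definition is_norm (R : realType) (V : lmodType R[i]) (N : V -> R) : Prop :=
  [/\ forall x, 0 <= N x,
      forall x, N x = 0 -> x = 0,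
      forall (a : R[i]) x, N (a *: x) = rnorm a * N x &
      forall x y, N (x + y) <= N x + N y].

(* [N k] is the norm on E^k; its value at k = 0 is irrelevant. *)
Record is_multinorm (R : realType) (E : normedModType R[i])
    (N : forall k : nat, ('I_k -> E) -> R) : Prop := {
  multinorm_norm : forall k, (1 <= k)%N -> is_norm (N k);
  multinorm1 : forall x : E, N 1 (fun=> x) = rnorm x;
  multinormA1 : forall k (s : 'S_k) (x : 'I_k -> E), (2 <= k)%N ->
    N k (fun i => x (s i)) = N k x;
  multinormA2 : forall k (a : 'I_k -> R[i]) (x : 'I_k -> E), (2 <= k)%N ->
    N k (fun i => a i *: x i) <= (\big[Num.max/0]_(i < k) rnorm (a i)) * N k x;
  multinormA3 : forall k (x : 'I_k.+1 -> E),
    N k.+2 (fsnoc x 0) = N k.+1 x;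
  multinormA4 : forall k (x : 'I_k.+1 -> E),
    N k.+2 (fsnoc x (x ord_max)) = N k.+1 x }.

Definition max_multinorm (R : realType) (E : normedModType R[i]) (n : nat)
    (x : 'I_n -> E) : \bar R :=
  ereal_sup [set (N n x)%:E | N in @is_multinorm R E].

Definition phi_max (R : realType) (E : normedModType R[i]) (n : nat) : \bar R :=
  ereal_sup [set max_multinorm x |
    x in [set x : 'I_n -> E | forall i, rnorm (x i) <= 1]].

Definition dual_norm (R : realType) (F : normedModType R[i])
    (l : {linear F -> R[i]^o}) : \bar R :=
  ereal_sup [set (rnorm (l x))%:E | x in [set x : F | rnorm x <= 1]].

(* The closed unit ball of the dual space F'. *)
Definition dual_ball (R : realType) (F : normedModType R[i]) :
    set {linear F -> R[i]^o} :=
  [set l : {linear F -> R[i]^o} | continuous l /\ (dual_norm l <= 1)%E].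

(* mu_{1,m} *)
Definition weak1norm (R : realType) (F : normedModType R[i]) (m : nat)
    (x : 'I_m -> F) : \bar R :=
  ereal_sup [set (\sum_(j < m) rnorm (l (x j)))%:E | l in @dual_ball R F].

(* The supremum C_q for F = l^q; as an element of \bar R it makes sense whether
   or not F has the Orlicz property. *)
Definition orlicz_const (R : realType) (F : normedModType R[i]) : \bar R :=
  ereal_sup [set c | exists m (x : 'I_m -> F),
    [/\ (1 <= m)%N, (weak1norm x <= 1)%E &
        c = (Num.sqrt (\sum_(j < m) rnorm (x j) ^+ 2))%:E]].

(* Main.v *)
(* Upper bounds. For a multi-norm N on l^p, Hahn-Banach gives functionals l_1, ..., l_n with
   N(x) = Re sum_i l_i(x_i) and |sum_i l_i(y_i)| <= N(y); since N(a_1 z, ..., a_n z) <= ||z||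
   for |a_i| <= 1, these satisfy sum_i |l_i(z)| <= ||z||. For p >= 2 the definition of the
   Orlicz constant bounds (sum_i ||l_i||^2)^(1/2), and Cauchy-Schwarz finishes. For
   1 < p <= 2, every choice of signs gives ||sum_i +-l_i||_q <= 1, and Clarkson's inequality
   yields sum_i ||l_i||_q^q <= 1, so that Hoelder gives n^(1/p). To avoid the dual of l^oo,
   the x_i are first approximated by vectors of a finite-dimensional l^p.

   Lower bounds. On l^r_n, M(x) = || max_i |x_i| ||_r is a multi-norm with
   M(e_1, ..., e_n) = n^(1/r), and for a linear contraction P : E -> F and a multi-norm M on F,
   max(max_i ||x_i||, M(P x_1, ..., P x_n)) is a multi-norm on E. For p <= 2 take P = id; for
   p >= 2 let P be the suitably scaled Fourier matrix from l^p_n to l^2_n. Restriction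
   from l^p to l^p_n gives phi(l^p_n) <= phi(l^p). *)
Require Import Defs.
From mathcomp Require Import all_boot all_order all_algebra all_fingroup.
From mathcomp Require Import cyclic separable cyclotomic.
From mathcomp Require Import finmap complex.
From mathcomp Require Import all_classical all_reals all_analysis.
From mathcomp Require Import ring lra.
Set Implicit Arguments.
Unset Strict Implicit.
Unset Printing Implicit Defensive.
Import Order.TTheory GRing.Theory Num.Theory.
Import numFieldNormedType.Exports.

Local Open Scope classical_set_scope.
Local Open Scope ring_scope.

(** * Hahn-Banach for finitely many vectors *)

Section HahnBanach.
Context {R : realType} {V : lmodType R[i]} (N : V -> R).
Hypothesis normZ : forall (a : R[i]) x, N (a *: x) = rnorm a * N x.
Hypothesis normD : forall x y, N (x + y) <= N x + N y.

Lemma rnorm_real (t : R) : rnorm t%:C%C = `|t|.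
Proof. by rewrite /rnorm normc_def /= expr0n addr0 sqrtr_sqr. Qed.

Let norm_scale (t : R) x : 0 <= t -> N (t%:C%C *: x) = t * N x.
Proof. by move=> t0; rewrite normZ rnorm_real ger0_norm. Qed.

Lemma hahn_banach_seq (J : eqType) (v : J -> V) (x0 : V) (s : seq J) : uniq s ->
  exists c : J -> R, forall (t0 : R) (t : J -> R),
    t0 * N x0 + \sum_(j <- s) t j * c j <=
    N (t0%:C%C *: x0 + \sum_(j <- s) (t j)%:C%C *: v j).
Proof.
have N0 x : 0 <= N x.
  have := normD x (- x); rewrite subrr -scaleN1r normZ.
  have -> : N 0 = 0 by rewrite -(scale0r (0 : V)) normZ rnorm0 mul0r.
  by rewrite /rnorm normrN1 mul1r; lra.
elim: s => [_|w s IH /= /andP[ws us]].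
  exists (fun=> 0) => t0 t; rewrite !big_nil !addr0 normZ rnorm_real.
  by apply: ler_wpM2r => //; exact: ler_norm.
have [c hc] := IH us.
pose f (t0 : R) (t : J -> R) := t0 * N x0 + \sum_(j <- s) t j * c j.
pose u (t0 : R) (t : J -> R) := t0%:C%C *: x0 + \sum_(j <- s) (t j)%:C%C *: v j.
have fD t0 t t0' t' : f t0 t + f t0' t' = f (t0 + t0') (fun j => t j + t' j).
  rewrite /f mulrDl addrACA -big_split/=; congr (_ + _).
  by apply: eq_bigr => j _; rewrite mulrDl.
have uD t0 t t0' t' : u t0 t + u t0' t' = u (t0 + t0') (fun j => t j + t' j).
  rewrite /u rmorphD scalerDl addrACA -big_split/=; congr (_ + _).
  by apply: eq_bigr => j _; rewrite rmorphD scalerDl.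
have fZ a t0 t : f (a * t0) (fun j => a * t j) = a * f t0 t.
  rewrite /f mulrDr mulrA mulr_sumr; congr (_ + _).
  by apply: eq_bigr => j _; rewrite mulrA.
have uZ a t0 t : u (a * t0) (fun j => a * t j) = a%:C%C *: u t0 t.
  rewrite /u scalerDr scalerA rmorphM scaler_sumr; congr (_ + _).
  by apply: eq_bigr => j _; rewrite rmorphM scalerA.
(* [S] collects the lower constraints on the value at [v w]. By the triangle inequality each of them
   lies below every upper constraint [N (u + v w) - f], so [sup S] is an admissible value. *)
pose S : set R := [set f z.1 z.2 - N (u z.1 z.2 - v w) | z in [set: R * (J -> R)]].
have ubS z : ubound S (N (u z.1 z.2 + v w) - f z.1 z.2).
  move=> _ [y _ <-]; have := hc (y.1 + z.1) (fun j => y.2 j + z.2 j).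
  rewrite -/(f _ _) -/(u _ _) -fD -uD.
  have := normD (u y.1 y.2 - v w) (u z.1 z.2 + v w).
  by rewrite addrACA addNr addr0; lra.
have S0 : S !=set0.
  by exists (f 0 (fun=> 0) - N (u 0 (fun=> 0) - v w)); exists (0, (fun=> 0)).
have hub z : sup S <= N (u z.1 z.2 + v w) - f z.1 z.2.
  by apply: ge_sup => //; exact: ubS.
have hlb z : f z.1 z.2 - N (u z.1 z.2 - v w) <= sup S.
  apply: ub_le_sup; last by exists z.
  by exists (N (u 0 (fun=> 0) + v w) - f 0 (fun=> 0)); exact: (ubS (0, fun=> 0)).
exists (fun j => if j == w then sup S else c j) => t0 t.
rewrite !big_cons eqxx.
have -> : \sum_(j <- s) t j * (if j == w then sup S else c j) =
          \sum_(j <- s) t j * c j.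
  rewrite !big_seq; apply: eq_bigr => j js; case: eqP => // jw.
  by move: ws; rewrite -jw js.
rewrite addrCA -/(f t0 t) [X in N X]addrCA -/(u t0 t).
(* Dividing by the modulus of a nonzero [t w] reduces to coefficient -1 or 1 at [v w], that is, to a
   lower or an upper constraint. *)
have [tw|tw|tw] := ltrgt0P (t w); last first.
- by rewrite tw mul0r scale0r !add0r; exact: hc.
- have a0 : 0 < - t w by lra.
  have tE : t w = - - t w by rewrite opprK.
  have := hlb ((- t w)^-1 * t0, fun j => (- t w)^-1 * t j) => /=.
  rewrite fZ uZ => /(ler_wpM2l (ltW a0)).
  rewrite mulrBr mulrA mulfV ?gt_eqF// mul1r -(norm_scale _ (ltW a0)) scalerBr.
  rewrite scalerA -rmorphM mulfV ?gt_eqF// rmorph1 scale1r rmorphN scaleNr opprK.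
  by rewrite [_ + u t0 t]addrC; lra.
- have := hub ((t w)^-1 * t0, fun j => (t w)^-1 * t j) => /=.
  rewrite fZ uZ => /(ler_wpM2l (ltW tw)).
  rewrite mulrBr [X in _ - X]mulrA mulfV ?gt_eqF// mul1r -(norm_scale _ (ltW tw)).
  rewrite scalerDr.
  rewrite scalerA -rmorphM mulfV ?gt_eqF// rmorph1 scale1r.
  by rewrite [_ + u t0 t]addrC; lra.
Qed.

Lemma hahn_banach_fin (J : finType) (v : J -> V) (y : J -> R) :
  exists c : J -> R,
    (forall t : J -> R, \sum_j t j * c j <= N (\sum_j (t j)%:C%C *: v j)) /\
    N (\sum_j (y j)%:C%C *: v j) <= \sum_j y j * c j.
Proof.
have [c hc] := hahn_banach_seq v (\sum_j (y j)%:C%C *: v j) (index_enum_uniq J).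
exists c; split=> [t|].
  by have := hc 0 t; rewrite mul0r scale0r !add0r.
(* These coefficients give the zero vector, which forces the functional to attain the norm at the
   combination with coefficients [y]. *)
have := hc 1 (fun j => - y j); rewrite mul1r rmorph1 scale1r.
have -> : \sum_j - y j * c j = - \sum_j y j * c j.
  by rewrite -sumrN; apply: eq_bigr => j _; rewrite mulNr.
have -> : \sum_j (- y j)%:C%C *: v j = - \sum_j (y j)%:C%C *: v j.
  by rewrite -sumrN; apply: eq_bigr => j _; rewrite rmorphN scaleNr.
by rewrite subrr -(scale0r (0 : V)) normZ rnorm0 mul0r subr_le0.
Qed.

End HahnBanach.

(** * Moduli of complex numbers and Clarkson's inequality *)

Section Modulus.
Context {R : realType}.
Implicit Types a b : R[i].

Lemma rnorm_phase a : exists u : R[i], rnorm u = 1 /\ u * a = (rnorm a)%:C%C.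
Proof.
have [->|a0] := eqVneq a 0.
  by exists 1; rewrite mulr0 rnorm0 /rnorm normr1.
exists (a^-1 * `|a|); rewrite mulrAC mulVf// mul1r -rnormE; split => //.
by rewrite /rnorm normrM normfV normr_id mulVf// normr_eq0.
Qed.

Lemma rnorm_sum (I : Type) (s : seq I) (P : pred I) (f : I -> R[i]) :
  rnorm (\sum_(i <- s | P i) f i) <= \sum_(i <- s | P i) rnorm (f i).
Proof.
elim/big_ind2 : _ => //; first by rewrite rnorm0.
by move=> x a y b xa yb; apply: le_trans (rnormD _ _) _; exact: lerD.
Qed.

Lemma rnormN (V : normedZmodType R[i]) (x : V) : rnorm (- x) = rnorm x.
Proof. by rewrite /rnorm normrN. Qed.

Lemma rnormZ (V : normedModType R[i]) a (x : V) : rnorm (a *: x) = rnorm a * rnorm x.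
Proof. by apply: (@complexI R); rewrite rmorphM /= -!rnormE normrZ. Qed.

Lemma rnorm_sqr a : rnorm a ^+ 2 = complex.Re a ^+ 2 + complex.Im a ^+ 2.
Proof.
by rewrite /rnorm normc_def /= sqr_sqrtr// addr_ge0 ?sqr_ge0.
Qed.

Lemma Re_le_rnorm a : complex.Re a <= rnorm a.
Proof.
apply: le_trans (ler_norm _) _; rewrite -sqrtr_sqr /rnorm normc_def /=.
by rewrite ler_wsqrtr// lerDl sqr_ge0.
Qed.

Lemma parallelogram a b :
  rnorm (a + b) ^+ 2 + rnorm (a - b) ^+ 2 = 2 * (rnorm a ^+ 2 + rnorm b ^+ 2).
Proof. by rewrite !rnorm_sqr !raddfD !raddfN/=; ring. Qed.

Lemma le_powR (t u v : R) : 0 <= t -> 0 <= u -> u <= v -> u `^ t <= v `^ t.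
Proof.
move=> t0 u0 uv; apply: (ge0_ler_powR t0) => //; rewrite nnegrE//.
exact: le_trans uv.
Qed.

(** Each power is [u * u ^ (t - 1)], and the second factor grows when [u] is replaced by [u + v]. *)
Lemma powR_superadditive (u v t : R) : 0 <= u -> 0 <= v -> 1 <= t ->
  u `^ t + v `^ t <= (u + v) `^ t.
Proof.
move=> u0 v0 t1; have t0 : 0 < t by exact: lt_le_trans t1.
rewrite -(mulr_powRB1 (addr_ge0 u0 v0) t0) -(mulr_powRB1 u0 t0) -(mulr_powRB1 v0 t0).
rewrite mulrDl; have t10 : 0 <= t - 1 by lra.
by apply: lerD; apply: ler_wpM2l => //; apply: le_powR => //; lra.
Qed.

(** The parallelogram law is raised to the power [s / 2 >= 1]: superadditivity of the power handles
    the side of [a] and [b], its convexity the side of [a + b] and [a - b]. *)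
Lemma clarkson_powR a b (s : R) : 2 <= s ->
  2 * (rnorm a `^ s + rnorm b `^ s) <= rnorm (a + b) `^ s + rnorm (a - b) `^ s.
Proof.
move=> s2; have t1 : 1 <= s / 2 by lra.
have pE (x : R[i]) : rnorm x `^ s = (rnorm x ^+ 2) `^ (s / 2).
  rewrite -powR_mulrn ?rnorm_ge0// -powRrM; congr (_ `^ _).
  by rewrite mulrC divfK// pnatr_eq0.
rewrite !pE; move: (parallelogram a b).
have := sqr_ge0 (rnorm (a + b)); have := sqr_ge0 (rnorm (a - b)).
have := sqr_ge0 (rnorm a); have := sqr_ge0 (rnorm b).
move: (rnorm (a + b) ^+ 2) (rnorm (a - b) ^+ 2) (rnorm a ^+ 2) (rnorm b ^+ 2).
move=> A B u v v0 u0 B0 A0 AB.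
have := powR_superadditive u0 v0 t1.
have := powR_conv_le t1 ltr01 ltr01 A0 B0; rewrite AB powRM ?addr_ge0// powR1 divr1.
have -> : (1 + 1 : R) = 2 by [].
rewrite -mulrDr mul1r -mulrA ler_pM2l ?powR_gt0//.
by lra.
Qed.

End Modulus.

(** * Hoelder's inequality and duality for finite families *)

Section FiniteHoelder.
Context {R : realType}.

(** Young's inequality is applied termwise after normalising both families; if one of the norms
    vanishes, so do all products. *)
Lemma hoelder_sum (J : finType) (a b : J -> R) (r s : R) :
  0 < r -> 0 < s -> r^-1 + s^-1 = 1 ->
  (forall j, 0 <= a j) -> (forall j, 0 <= b j) ->
  \sum_j a j * b j <=
  (\sum_j a j `^ r) `^ r^-1 * (\sum_j b j `^ s) `^ s^-1.
Proof.
move=> r0 s0 rs a0 b0.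
have sum0 (c : J -> R) t : \sum_j c j `^ t = 0 -> forall j, c j = 0.
  move=> /eqP; rewrite psumr_eq0; last by move=> j _; exact: powR_ge0.
  by move=> /allP ct j; apply/(@powR_eq0_eq0 _ _ t)/eqP/ct; rewrite mem_index_enum.
have ge0 (c : J -> R) t : 0 <= \sum_j c j `^ t.
  by apply: sumr_ge0 => j _; exact: powR_ge0.
have [A0|A0] := eqVneq (\sum_j a j `^ r) 0.
  by rewrite big1 ?mulr_ge0 ?powR_ge0// => j _; rewrite (sum0 _ _ A0) mul0r.
have [B0|B0] := eqVneq (\sum_j b j `^ s) 0.
  by rewrite big1 ?mulr_ge0 ?powR_ge0// => j _; rewrite (sum0 _ _ B0) mulr0.
set A := (\sum_j a j `^ r) `^ r^-1; set B := (\sum_j b j `^ s) `^ s^-1.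
have Agt : 0 < A by rewrite powR_gt0// lt_neqAle eq_sym A0 ge0.
have Bgt : 0 < B by rewrite powR_gt0// lt_neqAle eq_sym B0 ge0.
have AE : A `^ r = \sum_j a j `^ r by rewrite -powRrM mulVf ?gt_eqF// powRr1.
have BE : B `^ s = \sum_j b j `^ s by rewrite -powRrM mulVf ?gt_eqF// powRr1.
clearbody A B.
rewrite -[leRHS]mulr1 -ler_pdivrMl ?mulr_gt0// mulr_sumr.
apply: (@le_trans _ _ (\sum_j (a j `^ r / A `^ r / r + b j `^ s / B `^ s / s))).
  apply: ler_sum => j _.
  have divE (x y t : R) : 0 <= x -> 0 < y -> x `^ t / y `^ t = (x / y) `^ t.
    move=> x0 y0; rewrite -powRN powRM//; last by rewrite invr_ge0 ltW.
    by rewrite -powR_inv1 ?ltW// -powRrM mulN1r.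
  rewrite (divE _ _ r (a0 j) Agt) (divE _ _ s (b0 j) Bgt).
  apply: le_trans (conjugate_powR (divr_ge0 (a0 j) (ltW Agt))
    (divr_ge0 (b0 j) (ltW Bgt)) r0 s0 rs).
  by rewrite invfM mulrACA [A^-1 * _]mulrC [B^-1 * _]mulrC.
rewrite big_split/= -!mulr_suml AE BE !mulfV// !mul1r.
by rewrite rs.
Qed.

Context {K : finType}.
Implicit Types z w : K -> R[i].

Lemma esum_finE (f : K -> R) : (forall k, 0 <= f k) ->
  (\esum_(k in [set: K]) (f k)%:E = (\sum_k f k)%:E)%E.
Proof.
move=> f0; rewrite esum_fset; last 2 first.
- exact: finite_finset.
- by move=> k _; rewrite lee_fin.
have -> : [set: K] = [set` index_enum K].
  by apply/seteqP; split => // k _ /=; rewrite mem_index_enum.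
by rewrite -fsbig_seq ?index_enum_uniq// sumEFin.
Qed.

Lemma lpnorm_sumE (r : R) z : 1 <= r ->
  fine (lpnorm r%:E z) = (\sum_k rnorm (z k) `^ r) `^ r^-1.
Proof. by move=> r1; rewrite /lpnorm esum_finE// => k; exact: powR_ge0. Qed.

Lemma lpnorm_fin_le (p : \bar R) z (c : R) : (1 <= p)%E -> 0 <= c ->
  (lpnorm p z <= c%:E)%E = (fine (lpnorm p z) <= c).
Proof.
move=> p1 c0; apply/idP/idP => [|zc]; first exact: fine_lpnorm_le.
by apply: le_trans (lpnorm_le_fine (lpnorm_fintype z p1)) _; rewrite lee_fin.
Qed.

Lemma rnorm_le_lpnormy z k : rnorm (z k) <= fine (lpnorm +oo%E z).
Proof.
rewrite -lee_fin; apply: le_trans (lpnorm_le_fine (lpnorm_fintype z (leey 1))).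
by apply: ereal_sup_ubound; exists k.
Qed.

Lemma conjugate_casesP (p q : \bar R) : (1 <= p)%E -> (1 <= q)%E ->
  (p^-1 + q^-1 = 1)%E ->
  [\/ exists r s : R, [/\ p = r%:E, q = s%:E, 1 < r, 1 < s & r^-1 + s^-1 = 1],
      p = 1%E /\ q = +oo%E | p = +oo%E /\ q = 1%E].
Proof.
case: p => [r| |] //; case: q => [s| |] //; rewrite ?lee_fin.
- move=> r1 s1; rewrite !inver !gt_eqF ?(lt_le_trans ltr01)// -EFinD => -[rs].
  have r0 : 0 < r by lra.
  have s0 : 0 < s by lra.
  have ri : 0 < r^-1 by rewrite invr_gt0.
  have si : 0 < s^-1 by rewrite invr_gt0.
  by constructor 1; exists r, s; split => //; rewrite -invf_lt1//; lra.
- move=> r1 _; rewrite invey adde0 => /eqP; rewrite inve_eq1 => /eqP ->.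
  by constructor 2.
- move=> _ s1; rewrite invey add0e => /eqP; rewrite inve_eq1 => /eqP ->.
  by constructor 3.
- by move=> _ _; rewrite invey add0e => -[] /eqP; rewrite eq_sym oner_eq0.
Qed.

Lemma hoelder_lpnorm (p q : \bar R) (w z : K -> R[i]) :
  (1 <= p)%E -> (1 <= q)%E -> (p^-1 + q^-1 = 1)%E ->
  rnorm (\sum_k w k * z k) <= fine (lpnorm p w) * fine (lpnorm q z).
Proof.
move=> p1 q1 pq; apply: le_trans (rnorm_sum _ _ _) _.
under eq_bigr do rewrite rnormM.
have case1 (u v : K -> R[i]) :
    \sum_k rnorm (u k) * rnorm (v k) <= fine (lpnorm 1 u) * fine (lpnorm +oo v).
  rewrite lpnorm_sumE// invr1 powRr1 ?sumr_ge0// => [|k _]; last exact: powR_ge0.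
  rewrite mulr_suml; apply: ler_sum => k _; rewrite powRr1 ?rnorm_ge0//.
  by rewrite ler_wpM2l ?rnorm_ge0// rnorm_le_lpnormy.
case: (conjugate_casesP p1 q1 pq) => [[r [s [-> -> r1 s1 rs]]]|[-> ->]|[-> ->]].
- rewrite !lpnorm_sumE ?(ltW r1) ?(ltW s1)//.
  have := hoelder_sum (a := fun k => rnorm (w k)) (b := fun k => rnorm (z k))
    (lt_trans ltr01 r1) (lt_trans ltr01 s1) rs.
  by apply=> k; exact: rnorm_ge0.
- exact: case1.
- by under eq_bigr do rewrite mulrC; rewrite mulrC; exact: case1.
Qed.

Lemma lpnorm_le1_dual (p q : \bar R) (z : K -> R[i]) :
  (1 <= p)%E -> (1 <= q)%E -> (p^-1 + q^-1 = 1)%E -> p != 1%E ->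
  (forall w : K -> R[i], rnorm (\sum_k w k * z k) <= fine (lpnorm q w)) ->
  fine (lpnorm p z) <= 1.
Proof.
move=> p1 q1 pq pn1 hz; have [u hu] := choice (fun k => rnorm_phase (z k)).
have zu k : rnorm (u k) = 1 by have [] := hu k.
have uz k : u k * z k = (rnorm (z k))%:C%C by have [] := hu k.
case: (conjugate_casesP p1 q1 pq) hz pn1 => [[r [s [-> -> r1 s1 rs]]]|[-> ->]|[-> ->]] hz pn1.
- rewrite lpnorm_sumE ?(ltW r1) ?(ltW s1)//; set S := \sum_k _.
  have S0 : 0 <= S by apply: sumr_ge0 => k _; exact: powR_ge0.
  have [S1|S1] := leP S 1.
    have r0 : 0 <= r^-1 by rewrite invr_ge0; lra.
    by have := le_powR r0 S0 S1; rewrite powR1.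
  (* This is the equality case of Hoelder: the pairing with [z] is [S], and since [(r - 1) * s = r]
     the l^s-norm is [S ^ (1/s)]. The bound [S <= S ^ (1/s)] is impossible for [S > 1]. *)
  have := hz (fun k => (rnorm (z k) `^ (r - 1))%:C%C * u k).
  rewrite lpnorm_sumE ?(ltW r1) ?(ltW s1)//.
  have -> : \sum_k (rnorm (z k) `^ (r - 1))%:C%C * u k * z k = S%:C%C.
    rewrite rmorph_sum; apply: eq_bigr => k _; rewrite -mulrA uz -rmorphM mulrC.
    by rewrite mulr_powRB1 ?rnorm_ge0//; lra.
  rewrite rnorm_real ger0_norm//.
  have -> : \sum_k rnorm ((rnorm (z k) `^ (r - 1))%:C%C * u k) `^ s = S.
    apply: eq_bigr => k _; rewrite rnormM rnorm_real ger0_norm ?powR_ge0// zu mulr1.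
    rewrite -powRrM; congr (_ `^ _).
    have r0 : r != 0 by rewrite gt_eqF//; lra.
    have s0 : s != 0 by rewrite gt_eqF//; lra.
    have : (r^-1 + s^-1) * (r * s) = r * s by rewrite rs mul1r.
    rewrite mulrDl mulrA mulVf// mul1r [r * s]mulrC mulrA mulVf// mul1r.
    lra.
  rewrite leNgt -[X in _ < X]powRr1//.
  have -> : S `^ s^-1 < S `^ 1.
    rewrite /powR gt_eqF ?(lt_trans ltr01)// ltr_expR ltr_pM2r ?ln_gt0//.
    have : 0 < r^-1 by rewrite invr_gt0; lra.
    lra.
  by [].
- by move: pn1; rewrite eqxx.
- rewrite -(lpnorm_fin_le _ (leey 1) ler01) (lpnorm_finP _ (leey 1) ler01); apply/asboolP => k.
  (* For [p = +oo] a unit vector of l^1, rotated by the phase of [z k], isolates one coordinate. *)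
  have := hz (fun j => if j == k then u k else 0).
  rewrite (bigD1 k)//= eqxx big1 => [|j /negbTE ->]; last by rewrite mul0r.
  rewrite addr0 uz rnorm_real ger0_norm ?rnorm_ge0// => /le_trans; apply.
  rewrite lpnorm_sumE// invr1 powRr1 ?sumr_ge0// => [|j _]; last exact: powR_ge0.
  rewrite (bigD1 k)//= eqxx big1 ?addr0 => [|j /negbTE ->].
    by rewrite zu powR1.
  by rewrite rnorm0 powR0 ?oner_eq0.
Qed.

End FiniteHoelder.

Lemma sum_pairE (V : nmodType) (I J : finType) (f : I * J -> V) :
  \sum_h f h = \sum_i \sum_j f (i, j).
Proof. by rewrite pair_bigA; apply: eq_bigr => -[]. Qed.

(** * General bounds for multi-norms and their dominated functionals *)

Section MultinormBounds.
Context {R : realType} {E : normedModType R[i]} {N : forall k : nat, ('I_k -> E) -> R}.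
Hypothesis multiN : is_multinorm N.

Lemma multinorm_diag (k : nat) (z : E) : (1 <= k)%N -> N (fun _ : 'I_k => z) = rnorm z.
Proof.
case: k => // k _; elim: k => [|k IH]; first exact: (multinorm1 multiN).
rewrite -IH -[RHS](multinormA4 multiN); congr (N _); apply/funext => i.
by rewrite /fsnoc; case: unlift.
Qed.

(** This estimate turns functionals dominated by [N] into weakly summing families. The case [k = 1]
    is treated apart, as (A2) starts at [k = 2]. *)
Lemma multinorm_scale_diag (k : nat) (a : 'I_k -> R[i]) (c : R) (z : E) :
  (1 <= k)%N -> 0 <= c -> (forall i, rnorm (a i) <= c) ->
  N (fun i => a i *: z) <= c * rnorm z.
Proof.
case: k a => [//|[|k]] a _ c0 ac.
  have -> : (fun i => a i *: z) = fun=> a ord0 *: z.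
    by apply/funext => i; rewrite ord1.
  by rewrite (multinorm1 multiN) rnormZ ler_wpM2r ?rnorm_ge0.
apply: le_trans (multinormA2 multiN a (fun=> z) _) _ => //.
by rewrite multinorm_diag// ler_wpM2r ?rnorm_ge0//; apply: bigmax_le.
Qed.

Lemma multinorm_le_sum (k : nat) (x : 'I_k -> E) : (1 <= k)%N ->
  N x <= \sum_i rnorm (x i).
Proof.
move=> k1; have [N0 _ NZ ND] := multinorm_norm multiN k1.
have Nsum (s : seq 'I_k) (f : 'I_k -> 'I_k -> E) :
    N (\sum_(i <- s) f i) <= \sum_(i <- s) N (f i).
  elim/big_ind2 : _ => //; first by rewrite -(scale0r (0 : 'I_k -> E)) NZ rnorm0 mul0r.
  by move=> u a v b ua vb; apply: le_trans (ND _ _) _; exact: lerD.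
(* Each summand is supported in one slot and is a multiple, with coefficients 0 and 1, of a constant
   tuple. *)
have -> : x = \sum_i (fun j => (j == i)%:R *: x i).
  apply/funext => j; rewrite fct_sumE (bigD1 j)//= eqxx scale1r big1 ?addr0//.
  by move=> i /negbTE; rewrite eq_sym => ->; rewrite scale0r.
apply: le_trans (Nsum _ _) _; apply: ler_sum => i _.
rewrite fct_sumE (bigD1 i)//= eqxx scale1r big1 ?addr0; last first.
  by move=> j /negbTE; rewrite eq_sym => ->; rewrite scale0r.
rewrite -[leRHS]mul1r; apply: multinorm_scale_diag => // j.
by case: eqP => _; rewrite ?rnorm0// /rnorm normr1.
Qed.

(** [l i k] is the value at [v k] of the [i]-th component of a functional on tuples from the span of
    [v]. The first conclusion says that the components are weakly summing, the second that the
    functional norms the given tuple. *)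
Lemma multinorm_functional (n : nat) (K : finType) (v : K -> E)
    (z : 'I_n -> K -> R[i]) : (1 <= n)%N ->
  exists l : 'I_n -> K -> R[i],
    (forall w : K -> R[i],
      \sum_i rnorm (\sum_k l i k * w k) <= rnorm (\sum_k w k *: v k)) /\
    N (fun i => \sum_k z i k *: v k) <= rnorm (\sum_i \sum_k l i k * z i k).
Proof.
move=> n1; have [N0 _ NZ ND] := multinorm_norm multiN n1.
pose J : finType := ('I_n * K * bool)%type.
(* The real span of the vectors [v k] and ['i *: v k], each placed in a single slot, contains all
   tuples in question; [co] gives the real coordinates. *)
pose vv (h : J) : 'I_n -> E := fun j =>
  if j == h.1.1 then (if h.2 then 'i else 1)%C *: v h.1.2 else 0.
pose co (y : 'I_n -> K -> R[i]) (h : J) : R :=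
  if h.2 then complex.Im (y h.1.1 h.1.2) else complex.Re (y h.1.1 h.1.2).
have coE y : \sum_h (co y h)%:C%C *: vv h = fun i => \sum_k y i k *: v k.
  apply/funext => i; rewrite fct_sumE.
  have -> : \sum_h ((co y h)%:C%C *: vv h) i =
      \sum_(u : 'I_n * K) (if i == u.1 then y u.1 u.2 *: v u.2 else 0).
    rewrite sum_pairE; apply: eq_bigr => -[j k] _; rewrite big_bool/= /co /vv/= !scalrfctE.
    case: eqP => _; last by rewrite !scaler0 addr0.
    rewrite !scalerA -scalerDl; congr (_ *: _).
    by rewrite [RHS]complexE mulr1 addrC mulrC.
  rewrite sum_pairE/=.
  rewrite (bigD1 i)//= eqxx [X in _ + X]big1 ?addr0// => j /negbTE ij.
  by rewrite eq_sym ij big1.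
have [c [cle cge]] := hahn_banach_fin NZ ND vv (co z).
(* The usual complexification [f y - 'i * f ('i y)] of a real functional [f]. *)
pose l i k : R[i] := (c (i, k, false))%:C%C - 'i%C * (c (i, k, true))%:C%C.
have lE y : complex.Re (\sum_i \sum_k l i k * y i k) = \sum_h co y h * c h.
  rewrite !sum_pairE.
  rewrite raddf_sum; apply: eq_bigr => i _; rewrite raddf_sum; apply: eq_bigr => k _.
  rewrite big_bool /co /l/=; case: (y i k) => a b.
  by simpc => /=; ring.
exists l; split=> [w|]; last first.
  rewrite -coE; apply: le_trans cge _; rewrite -lE; exact: Re_le_rnorm.
(* The phases turn the sum of moduli into the real functional at a tuple of unimodular multiples of
   one vector. *)
have [u hu] := choice (fun i => rnorm_phase (\sum_k l i k * w k)).
have -> : \sum_i rnorm (\sum_k l i k * w k) =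
    complex.Re (\sum_i \sum_k l i k * (u i * w k)).
  rewrite raddf_sum; apply: eq_bigr => i _.
  have -> : \sum_k l i k * (u i * w k) = u i * \sum_k l i k * w k.
    by rewrite mulr_sumr; apply: eq_bigr => k _; rewrite mulrCA.
  by have [_ ->] := hu i.
rewrite (lE (fun i k => u i * w k)); apply: le_trans (cle _) _.
rewrite (coE (fun i k => u i * w k)) -[leRHS]mul1r.
have -> : (fun i => \sum_k (u i * w k) *: v k) =
          (fun i => u i *: \sum_k w k *: v k).
  by apply/funext => i; rewrite scaler_sumr; apply: eq_bigr => k _; rewrite scalerA.
by apply: multinorm_scale_diag => // i; have [-> _] := hu i.
Qed.

End MultinormBounds.

Lemma phi_max_le (R : realType) (E : normedModType R[i]) (n : nat) (B : \bar R) :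
  (forall (N : forall k : nat, ('I_k -> E) -> R) (x : 'I_n -> E), is_multinorm N ->
    (forall i, rnorm (x i) <= 1) -> ((N n x)%:E <= B)%E) ->
  (phi_max E n <= B)%E.
Proof.
move=> h; apply: ge_ereal_sup => _ [x x1 <-].
by apply: ge_ereal_sup => _ [N NN <-]; exact: h.
Qed.

Lemma le_phi_max (R : realType) (E : normedModType R[i]) (n : nat)
    (N : forall k : nat, ('I_k -> E) -> R) (x : 'I_n -> E) : is_multinorm N ->
  (forall i, rnorm (x i) <= 1) -> ((N n x)%:E <= phi_max E n)%E.
Proof.
move=> NN x1; apply: (@le_trans _ _ (max_multinorm x)).
  by apply: ereal_sup_ubound; exists N.
by apply: ereal_sup_ubound; exists x.
Qed.

(** * Weakly summing families of functionals on a finite l^p *)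

Section Summing.
Context {R : realType} {K : finType}.

(* Averaging over the sign of each term, Clarkson's inequality says that ||a + b||^s or
   ||a - b||^s is at least ||a||^s + ||b||^s, so the signs can be chosen greedily. *)
Lemma exists_signs (I : eqType) (l : I -> K -> R[i]) (s : R) (t : seq I) :
  2 <= s -> uniq t ->
  exists e : I -> R[i], (forall i, rnorm (e i) = 1) /\
    \sum_(i <- t) \sum_k rnorm (l i k) `^ s <=
    \sum_k rnorm (\sum_(i <- t) e i * l i k) `^ s.
Proof.
move=> s2; have s0 : s != 0 by rewrite gt_eqF//; lra.
elim: t => [_|j t IH /= /andP[jt ut]].
  exists (fun=> 1); split=> [i|]; first by rewrite /rnorm normr1.
  rewrite big_nil; apply: sumr_ge0 => k _; exact: powR_ge0.
have [e [e1 he]] := IH ut; rewrite big_cons.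
pose a k := \sum_(i <- t) e i * l i k.
have aE (u : R[i]) k :
    \sum_(i <- j :: t) (if i == j then u else e i) * l i k = a k + u * l j k.
  rewrite big_cons eqxx addrC; congr (_ + _).
  rewrite /a !big_seq; apply: eq_bigr => i it; case: eqP => // ij.
  by move: jt; rewrite -ij it.
have : 2 * (\sum_k rnorm (l j k) `^ s + \sum_(i <- t) \sum_k rnorm (l i k) `^ s) <=
    \sum_k rnorm (a k + l j k) `^ s + \sum_k rnorm (a k - l j k) `^ s.
  rewrite addrC -big_split/=; apply: le_trans (_ : 2 * (\sum_k rnorm (a k) `^ s +
      \sum_k rnorm (l j k) `^ s) <= _); first by rewrite ler_pM2l ?lerD2r.
  rewrite -big_split mulr_sumr; apply: ler_sum => k _; exact: clarkson_powR.
set S := (X in 2 * X); set P := (X in _ <= X + _) => h.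
have [SP|PS] := leP S P.
- exists (fun i => if i == j then 1 else e i); split=> [i|].
    by case: eqP => _; rewrite // /rnorm normr1.
  rewrite [leRHS](_ : _ = P)//; apply: eq_bigr => k _.
  by rewrite (aE 1) mul1r.
- have SQ : S <= \sum_k rnorm (a k - l j k) `^ s by move: h PS; clearbody S P; lra.
  exists (fun i => if i == j then -1 else e i); split=> [i|].
    by case: eqP => _; rewrite // rnormN /rnorm normr1.
  rewrite [leRHS](eq_bigr (fun k => rnorm (a k - l j k) `^ s)) => [|k _]; last first.
    by rewrite (aE (- 1)) mulN1r.
  by apply: le_trans SQ; rewrite lexx.
Qed.

(** By duality every unimodular combination of the [l i] has l^s-norm at most 1, so suitable signs
    give a bound 1 on the sum of all [|l i k|^s]. Hoelder over pairs [(i, k)] then leaves the factor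
    [n ^ (1/r)] from the [z i]. *)
Lemma weakly_summing_pairing_le (n : nat) (l z : 'I_n -> K -> R[i]) (r s : R) :
  1 < r -> 2 <= s -> r^-1 + s^-1 = 1 ->
  (forall w : K -> R[i], \sum_i rnorm (\sum_k l i k * w k) <= fine (lpnorm r%:E w)) ->
  (forall i, fine (lpnorm r%:E (z i)) <= 1) ->
  rnorm (\sum_i \sum_k l i k * z i k) <= n%:R `^ r^-1.
Proof.
move=> r1 s2 rs lw z1.
have r0 : 0 < r by lra.
have s0 : 0 < s by lra.
have r1E : (1 <= r%:E)%E by rewrite lee_fin ltW.
have s1E : (1 <= s%:E)%E by rewrite lee_fin; lra.
have rsE : (r%:E^-1 + s%:E^-1 = 1)%E by rewrite !inver !gt_eqF// -EFinD rs.
have srE : (s%:E^-1 + r%:E^-1 = 1)%E by rewrite addeC.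
have [e [e1 he]] := exists_signs l s2 (index_enum_uniq 'I_n).
have : fine (lpnorm s%:E (fun k => \sum_i e i * l i k)) <= 1.
  apply: (lpnorm_le1_dual s1E r1E srE) => [|w].
    by rewrite eqe gt_eqF//; lra.
  apply: le_trans (lw w).
  have -> : \sum_k w k * (\sum_i e i * l i k) = \sum_i e i * \sum_k l i k * w k.
    under eq_bigr do rewrite mulr_sumr; rewrite exchange_big/=.
    apply: eq_bigr => i _; rewrite mulr_sumr; apply: eq_bigr => k _.
    by rewrite mulrCA [w k * _]mulrC.
  apply: le_trans (rnorm_sum _ _ _) _; apply: ler_sum => i _.
  by rewrite rnormM e1 mul1r.
rewrite -(lpnorm_fin_le _ s1E ler01) (lpnorm_finP _ s1E ler01) powR1.
rewrite esum_finE; last by move=> k; exact: powR_ge0.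
rewrite lee_fin => /(le_trans he) {he} he.
rewrite -(sum_pairE (fun h : 'I_n * K => l h.1 h.2 * z h.1 h.2)).
apply: le_trans (hoelder_lpnorm _ _ s1E r1E srE) _.
have s1 : 1 <= s by lra.
rewrite -[leRHS]mul1r !lpnorm_sumE ?(ltW r1)// !sum_pairE.
apply: ler_pM; rewrite ?powR_ge0//.
  have L0 : 0 <= \sum_i \sum_k rnorm (l i k) `^ s.
    by apply: sumr_ge0 => i _; apply: sumr_ge0 => k _; exact: powR_ge0.
  have si : 0 <= s^-1 by rewrite invr_ge0 ltW.
  by have := le_powR si L0 he; rewrite powR1.
apply: le_powR; rewrite ?invr_ge0 ?(ltW r0)//.
  by apply: sumr_ge0 => i _; apply: sumr_ge0 => k _; exact: powR_ge0.
rewrite -[leRHS]mulr1 mulr_natl -[n in leRHS]card_ord -sumr_const.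
apply: ler_sum => i _; move: (z1 i).
rewrite -(lpnorm_fin_le _ r1E ler01) (lpnorm_finP _ r1E ler01) powR1.
by rewrite esum_finE// => k; exact: powR_ge0.
Qed.

End Summing.

(** * Approximation in l^p by finite families *)

Lemma finite_set_nat_lt (X : set nat) : finite_set X ->
  exists m : nat, forall j, X j -> (j < m)%N.
Proof.
move=> finX; exists (\max_(j <- fset_set X) j).+1 => j Xj.
by rewrite ltnS; apply: leq_bigmax_seq => //; rewrite in_fset_set// inE.
Qed.

Lemma esum_tail_small (R : realType) (f : nat -> R) (e : R) :
  (forall j, 0 <= f j) -> (\esum_(j in [set: nat]) (f j)%:E < +oo)%E -> 0 < e ->
  exists m : nat, forall m', (m <= m')%N ->
    (\esum_(j in [set j | (m' <= j)%N]) (f j)%:E <= e%:E)%E.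
Proof.
move=> f0 foo e0; have f0' (j : nat) : (0 <= (f j)%:E)%E by rewrite lee_fin.
have Sfin : \esum_(j in [set: nat]) (f j)%:E \is a fin_num.
  by rewrite ge0_fin_numE// esum_ge0.
(* The finite set [X] carries all but [e] of the total, so every tail beyond [X] is small. *)
have [_ [X [finX _] <-] hX] := ub_ereal_sup_adherent e0 Sfin.
have [m hm] := finite_set_nat_lt finX; exists m => m' mm'.
have := esumID [set j | (j < m')%N] setT (fun j => (f j)%:E) (fun j _ => f0' j).
rewrite !setTI (_ : ~` _ = [set j | (m' <= j)%N]); last first.
  apply/seteqP; split => j /=.
    by move/negP; rewrite -leqNgt.
  by rewrite leqNgt => /negP.
have {}hX : (\esum_(j in [set: nat]) (f j)%:E - e%:E < \sum_(j \in X) (f j)%:E)%E by [].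
move: hX; have : (\sum_(j \in X) (f j)%:E <= \esum_(j in [set j | (j < m')%N]) (f j)%:E)%E.
  apply: esum_ge; exists X => //; split => // j /hm jm /=.
  exact: leq_trans jm mm'.
move: Sfin; set S := \esum_(_ in setT) _; set B := \esum_(_ in _) _.
set T := \esum_(_ in _) _; set Y := (\sum_(_ \in _) _)%E.
case: S => // s _ YB hY /esym sE.
have B0 : (0 <= B)%E by apply: esum_ge0.
have T0 : (0 <= T)%E by apply: esum_ge0.
case: B B0 YB sE => // [b|] b0 YB sE; last by move: T0 sE; case: T.
case: T T0 sE => // t _ []; have := lt_le_trans hY YB.
by rewrite -EFinB lte_fin lee_fin; lra.
Qed.

Section Lift.
Context {R : realType} {K : finType}.

(** The partial map [c] serves two purposes: a partial bijection gives extension by zero, and a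
    total map gives the functions constant on its fibres. *)
Definition lift_family (c : nat -> option K) (w : K -> R[i]) : nat -> R[i] :=
  fun j => oapp w 0 (c j).

Definition lift_contractive (p : \bar R) (c : nat -> option K) : Prop :=
  forall w : K -> R[i], (lpnorm p (lift_family c w) <= (fine (lpnorm p w))%:E)%E.

Lemma lift_finite (p : \bar R) (p1 : (1 <= p)%E) (c : nat -> option K)
    (hc : lift_contractive p c) (w : K -> R[i]) :
  lift_family c w \in finite_lpnorm p1.
Proof. by rewrite inE /=; apply: le_lt_trans (hc w) (ltry _). Qed.

Definition lift_lp (p : \bar R) (p1 : (1 <= p)%E) (c : nat -> option K)
    (hc : lift_contractive p c) (w : K -> R[i]) : lp nat p1 :=
  Lp (lift_finite p1 hc w).

Lemma lp_sumE (p : \bar R) (p1 : (1 <= p)%E) (I : choiceType) (J : Type) (s : seq J)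
    (f : J -> lp I p1) i : (\sum_(j <- s) f j : lp I p1) i = \sum_(j <- s) f j i.
Proof. by elim/big_rec2 : _ => //= j y1 y2 _ <-. Qed.

Lemma lift_lp_sum (p : \bar R) (p1 : (1 <= p)%E) (c : nat -> option K)
    (hc : lift_contractive p c) (w : K -> R[i]) :
  \sum_k w k *: lift_lp p1 hc (fun k' => (k' == k)%:R) = lift_lp p1 hc w.
Proof.
apply/val_inj/funext => j; rewrite [LHS]lp_sumE /= /lift_family.
under eq_bigr do rewrite scalrfctE /lift_family.
case: (c j) => [k|] /=; last by rewrite big1// => k _; rewrite scaler0.
rewrite (bigD1 k)//= eqxx [_ *: _]mulr1 big1 ?addr0// => k' /negbTE.
by rewrite eq_sym => ->; rewrite scaler0.
Qed.

Lemma esum_lift (c : nat -> option K) (d : K -> nat) (r : R) (w : K -> R[i]) :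
  r != 0 -> pcancel d c -> ocancel c d ->
  (\esum_(j in [set: nat]) (rnorm (lift_family c w j) `^ r)%:E =
   (\sum_k rnorm (w k) `^ r)%:E)%E.
Proof.
move=> r0 dK cK; rewrite -esum_finE; last by move=> k; exact: powR_ge0.
have di : set_inj [set: K] d by move=> k k' _ _ /(pcan_inj dK) ->.
transitivity (\esum_(j in d @` [set: K]) (rnorm (lift_family c w j) `^ r)%:E)%E.
  rewrite [RHS]esum_mkcond; apply: eq_esum => j _; case: ifPn => // /negP jd.
  rewrite /lift_family; case cj: (c j) => [k|] /=; last by rewrite rnorm0 powR0.
  case: jd; rewrite inE; exists k => //.
  by have := cK j; rewrite cj.
rewrite esum_image//; apply: eq_esum => k _.
by rewrite /lift_family dK.
Qed.

Lemma lpnorm_lift (c : nat -> option K) (d : K -> nat) (r : R) (w : K -> R[i]) :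
  1 <= r -> pcancel d c -> ocancel c d ->
  lpnorm r%:E (lift_family c w) = lpnorm r%:E w.
Proof.
move=> r1 dK cK; have r0 : r != 0 by rewrite gt_eqF//; lra.
by rewrite /lpnorm (esum_lift w r0 dK cK) esum_finE// => k; exact: powR_ge0.
Qed.

Lemma lift_contractivey (c : nat -> option K) : lift_contractive +oo%E c.
Proof.
move=> w; rewrite (lpnorm_finP _ (leey 1) (lpnorm_ge0 w (leey 1))).
apply/asboolP => j; rewrite /lift_family; case: (c j) => [k|] /=.
  exact: rnorm_le_lpnormy.
by rewrite rnorm0; apply: lpnorm_ge0 (leey 1).
Qed.

Lemma lift_partial_bij_contractive (p : \bar R) (c : nat -> option K) (d : K -> nat) :
  (1 <= p)%E -> pcancel d c -> ocancel c d -> lift_contractive p c.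
Proof.
case: p => [r| |]; [|by move=> *; exact: lift_contractivey|by []].
move=> r1 dK cK w; rewrite (lpnorm_lift w _ dK cK); last by rewrite -lee_fin.
exact/lpnorm_le_fine/lpnorm_fintype.
Qed.

End Lift.

Section Approximation.
Context {R : realType} {n : nat}.

(** All the [x i] are cut off at a common index [M], beyond which each sum of [|x i j|^r] is at most
    [e ^ r]. *)
Lemma lp_approx_fin (r : R) (r1 : (1 <= r%:E)%E) (x : 'I_n -> lp nat r1) (e : R) :
  (forall i, rnorm (x i) <= 1) -> 0 < e ->
  exists (K : finType) (v : K -> lp nat r1) (z : 'I_n -> K -> R[i]),
  [/\ forall w : K -> R[i], rnorm (\sum_k w k *: v k) <= fine (lpnorm r%:E w),
      forall i, fine (lpnorm r%:E (z i)) <= 1 &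
      forall i, rnorm (x i - \sum_k z i k *: v k) <= e].
Proof.
move=> x1 e0; have r1' : 1 <= r by rewrite -lee_fin.
have r0 : r != 0 by rewrite gt_eqF//; lra.
have xoo i : (\esum_(j in [set: nat]) (rnorm (x i j) `^ r)%:E < +oo)%E.
  have := lpnorm_le_fine (lp_finite (x i)).
  rewrite -lp_rnormE (lpnorm_finP _ r1 (rnorm_ge0 (x i))) => /le_lt_trans; apply.
  exact: ltry.
have [m hm] := choice (fun i => esum_tail_small (fun j => powR_ge0 _ _) (xoo i)
  (powR_gt0 r e0)).
pose M := \max_i m i; pose c (j : nat) : option 'I_M := insub j.
have dK : pcancel (@nat_of_ord M) c by exact: valK.
have cK : ocancel c (@nat_of_ord M) by exact: insubK.
have hc := lift_partial_bij_contractive r1 dK cK.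
have liftE i j : lift_family c (fun k => x i k) j = if (j < M)%N then x i j else 0.
  by rewrite /lift_family /c; case: insubP => [k -> <-|/negbTE ->].
exists 'I_M, (fun k => lift_lp r1 hc (fun k' => (k' == k)%:R)), (fun i (k : 'I_M) => x i k).
split=> [w|i|i].
- rewrite lift_lp_sum lp_rnormE; apply: fine_lpnorm_le; first exact: lpnorm_ge0.
  exact: hc.
- apply: fine_lpnorm_le; rewrite // -(lpnorm_lift _ r1' dK cK).
  have : (lpnorm r%:E (x i) <= 1%:E)%E.
    apply: le_trans (lpnorm_le_fine (lp_finite (x i))) _.
    by rewrite lee_fin -lp_rnormE.
  rewrite !(lpnorm_finP _ r1 ler01); apply: le_trans; apply: le_esum => j _.
  rewrite lee_fin liftE; case: ifP => // _.
  by rewrite rnorm0 powR0// powR_ge0.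
- rewrite lift_lp_sum lp_rnormE; apply: fine_lpnorm_le; first exact: ltW.
  rewrite (lpnorm_finP _ r1 (ltW e0)).
  apply: le_trans (hm i M (leq_bigmax i)).
  rewrite [leRHS]esum_mkcond; apply: le_esum => j _.
  rewrite [X in rnorm X](_ : _ = if (j < M)%N then 0 else x i j); last first.
    by rewrite /= -[LHS]/(x i j - lift_family c _ j) liftE; case: ifP; rewrite ?subrr ?subr0.
  case: ifPn => jM; first by rewrite rnorm0 powR0//; case: ifP; rewrite lee_fin ?powR_ge0.
  by rewrite mem_set//= leqNgt.
Qed.

(* Sorting the indices j by the cell of a fine grid that contains (x_1(j), ..., x_n(j))
   approximates the x_i by simple functions. *)
Lemma lp_approxy (y1 : (1 <= +oo :> \bar R)%E) (x : 'I_n -> lp nat y1) (e : R) :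
  (forall i, rnorm (x i) <= 1) -> 0 < e ->
  exists (K : finType) (v : K -> lp nat y1) (z : 'I_n -> K -> R[i]),
  [/\ forall w : K -> R[i], rnorm (\sum_k w k *: v k) <= fine (lpnorm +oo%E w),
      forall i, fine (lpnorm +oo%E (z i)) <= 1 &
      forall i, rnorm (x i - \sum_k z i k *: v k) <= e].
Proof.
move=> x1 e0; have x1' i j : rnorm (x i j) <= 1.
  have : (lpnorm +oo%E (x i) <= 1%:E)%E.
    apply: le_trans (lpnorm_le_fine (lp_finite (x i))) _.
    by rewrite lee_fin -lp_rnormE.
  by rewrite (lpnorm_finP _ y1 ler01) => /asboolP.
pose g (b : bool) (a : R[i]) : R := if b then complex.Im a else complex.Re a.
have g1 b i j : -1 <= g b (x i j) <= 1.
  rewrite -ler_norml -(@ler_pXn2r _ 2)// ?nnegrE//.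
  apply: le_trans (_ : rnorm (x i j) ^+ 2 <= _); last first.
    by rewrite ler_pXn2r// nnegrE ?rnorm_ge0.
  by rewrite rnorm_sqr real_normK ?num_real// /g; case: b; rewrite ?lerDl ?lerDr ?sqr_ge0.
(* The grid has mesh [1 / M < e / 2], which leaves [e / 2] each for the real and the imaginary
   part. *)
pose M := (Num.truncn (2 / e)).+1.
have eM : 2 / e < M%:R by have /truncn_itv/andP[] : 0 <= 2 / e by rewrite divr_ge0 ?ltW.
have M0 : 0 < M%:R :> R by rewrite ltr0n.
(* The shift by 1 moves the coordinates to [0, 2], where truncation is the floor; the labels then
   run from 0 to [2 * M]. *)
pose h (i : 'I_n) (b : bool) (j : nat) := Num.truncn ((g b (x i j) + 1) * M%:R).
have hM i b j : (h i b j < (2 * M).+1)%N.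
  rewrite ltnS -(ler_nat R) natrM; have /andP[g1l g1r] := g1 b i j.
  apply: le_trans (_ : (g b (x i j) + 1) * M%:R <= _).
    by rewrite truncn_le mulr_ge0 ?(ltW M0)//; lra.
  by rewrite ler_pM2r//; lra.
pose K : finType := {ffun 'I_n * bool -> 'I_(2 * M).+1}.
pose cell (j : nat) : K := [ffun u => inord (h u.1 u.2 j)].
(* [j0] picks a representative of each occupied cell; an empty cell gets the default 0, which still
   yields an entry of modulus at most 1. *)
have /choice[j0 hj0] : forall k, exists m, forall j, cell j = k -> cell m = k.
  move=> k; have [[j cj]|nk] := pselect (exists j, cell j = k).
    by exists j.
  by exists 0%N => j cj; case: nk; exists j.
have hc := lift_contractivey (R := R) (fun j => Some (cell j)).
exists K, (fun k => lift_lp y1 hc (fun k' => (k' == k)%:R)), (fun i k => x i (j0 k)).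
split=> [w|i|i].
- rewrite lift_lp_sum lp_rnormE; apply: fine_lpnorm_le; first exact: lpnorm_ge0.
  exact: hc.
- apply: fine_lpnorm_le => //; rewrite (lpnorm_finP _ y1 ler01).
  by apply/asboolP => k; exact: x1'.
- rewrite lift_lp_sum lp_rnormE; apply: fine_lpnorm_le; first exact: ltW.
  rewrite (lpnorm_finP _ y1 (ltW e0)); apply/asboolP => j.
  rewrite -[X in rnorm X]/(x i j - x i (j0 (cell j))).
  have := hj0 _ j erefl; set j' := j0 _ => jj'.
  have hE b : h i b j' = h i b j.
    by move/ffunP/(_ (i, b)) : jj'; rewrite !ffunE/= => /(congr1 val)/=; rewrite !inordK.
  have gE b : `|g b (x i j) - g b (x i j')| <= e / 2.
    have g0 j1 : 0 <= (g b (x i j1) + 1) * M%:R.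
      by have /andP[g1l _] := g1 b i j1; rewrite mulr_ge0 ?(ltW M0)//; lra.
    have /andP[l1 r1] := truncn_itv (g0 j); have /andP[l2 r2] := truncn_itv (g0 j').
    move: l1 r1 l2 r2; rewrite -/(h i b j) -/(h i b j') hE -natr1 => l1 r1 l2 r2.
    have : `|g b (x i j) - g b (x i j')| * M%:R <= 1.
      rewrite -[X in _ * X]ger0_norm ?(ltW M0)// -normrM ler_norml; lra.
    rewrite -ler_pdivlMr// mul1r => /le_trans; apply.
    rewrite -[leRHS]invrK lef_pV2 ?posrE// ?invr_gt0 ?divr_gt0//.
    by rewrite invf_div ltW.
  apply: le_trans (_ : `|g false (x i j) - g false (x i j')| +
                       `|g true (x i j) - g true (x i j')| <= _); last first.
    by have := gE false; have := gE true; lra.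
  rewrite -(@ler_pXn2r _ 2)// ?nnegrE ?rnorm_ge0 ?addr_ge0//.
  rewrite rnorm_sqr !raddfB/= [leRHS]sqrrD !real_normK ?num_real//.
  by rewrite lerD2r lerDl mulrn_wge0 ?mulr_ge0.
Qed.

Lemma lp_approx (p : \bar R) (p1 : (1 <= p)%E) (x : 'I_n -> lp nat p1) (e : R) :
  (forall i, rnorm (x i) <= 1) -> 0 < e ->
  exists (K : finType) (v : K -> lp nat p1) (z : 'I_n -> K -> R[i]),
  [/\ forall w : K -> R[i], rnorm (\sum_k w k *: v k) <= fine (lpnorm p w),
      forall i, fine (lpnorm p (z i)) <= 1 &
      forall i, rnorm (x i - \sum_k z i k *: v k) <= e].
Proof.
case: p p1 x => [r| |] p1 x; [exact: lp_approx_fin|exact: lp_approxy|].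
by have := p1.
Qed.

End Approximation.

(** * Upper bounds for [phi_max] on l^p *)

Section UpperBounds.
Context {R : realType}.

(* By Hahn-Banach, N is dominated by pairings with weakly summing families of functionals;
   finite index sets K suffice because finitely many vectors are approximable from K -> C. *)
Lemma multinorm_lp_le (p : \bar R) (p1 : (1 <= p)%E) (n : nat) (B : \bar R)
    (N : forall k : nat, ('I_k -> lp nat p1) -> R) (x : 'I_n -> lp nat p1) :
  (1 <= n)%N -> is_multinorm N -> (forall i, rnorm (x i) <= 1) ->
  (forall (K : finType) (l z : 'I_n -> K -> R[i]),
    (forall w : K -> R[i], \sum_i rnorm (\sum_k l i k * w k) <= fine (lpnorm p w)) ->
    (forall i, fine (lpnorm p (z i)) <= 1) ->
    ((rnorm (\sum_i \sum_k l i k * z i k))%:E <= B)%E) ->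
  ((N n x)%:E <= B)%E.
Proof.
move=> n1 NN x1 hB; apply/lee_addgt0Pr => e e0.
have n0 : 0 < n%:R :> R by rewrite ltr0n.
have [K [v [z [hv hz xz]]]] := lp_approx x1 (divr_gt0 e0 n0).
have [l [lw Nl]] := multinorm_functional NN v z n1.
have lB := hB K l z (fun w => le_trans (lw w) (hv w)) hz.
have [_ _ _ ND] := multinorm_norm NN n1.
have -> : x = (fun i => \sum_k z i k *: v k) + (fun i => x i - \sum_k z i k *: v k).
  by apply/funext => i; rewrite addrfctE addrC subrK.
apply: (@le_trans _ _ (rnorm (\sum_i \sum_k l i k * z i k) + e)%:E); last first.
  by rewrite EFinD leeD2r.
rewrite lee_fin; apply: le_trans (ND _ _) (lerD Nl _).
apply: le_trans (multinorm_le_sum NN _ n1) _.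
apply: (@le_trans _ _ (\sum_(i < n) e / n%:R)); first by apply: ler_sum => i _; exact: xz.
by rewrite sumr_const card_ord -[leLHS]mulr_natr divfK// gt_eqF.
Qed.

Lemma phi_max_lp_le_powR (r : R) (r1 : (1 <= r%:E)%E) (n : nat) :
  (1 <= n)%N -> r <= 2 -> (phi_max (lp nat r1) n <= (n%:R `^ r^-1)%:E)%E.
Proof.
move=> n1 r2; apply: phi_max_le => N x NN x1.
(* For [r = 1] the conjugate exponent is infinite, and the sum of the norms already gives [n]. *)
have [rE|rn1] := eqVneq r 1.
  rewrite rE invr1 powRr1 ?ler0n// lee_fin.
  apply: le_trans (multinorm_le_sum NN _ n1) _.
  by apply: le_trans (ler_sum _ (fun i _ => x1 i)) _; rewrite sumr_const card_ord.
have r1' : 1 < r by rewrite lt_neqAle eq_sym rn1 -lee_fin.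
have ri0 : 0 < r^-1 by rewrite invr_gt0; lra.
have ri1 : r^-1 < 1 by rewrite invf_lt1//; lra.
have ri2 : 2^-1 <= r^-1 by rewrite lef_pV2// posrE; lra.
pose s := (1 - r^-1)^-1.
have s2 : 2 <= s.
  by rewrite /s -[leLHS]invrK lef_pV2 ?posrE ?invr_gt0//; lra.
apply: (multinorm_lp_le n1 NN x1) => K l z lw z1; rewrite lee_fin.
by apply: (weakly_summing_pairing_le r1' s2 _ lw z1); rewrite /s invrK; lra.
Qed.

Lemma dual_ball_le (F : normedModType R[i]) (l : {linear F -> R[i]^o}) (x : F) :
  dual_ball l -> rnorm (l x) <= rnorm x.
Proof.
move=> [_ l1]; have [->|x0] := eqVneq x 0; first by rewrite linear0 !rnorm0.
have rx0 : 0 < rnorm x.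
  by rewrite lt_neqAle rnorm_ge0 andbT eq_sym; apply: contra_neq x0; exact: rnorm_eq0.
pose u : R[i] := ((rnorm x)^-1)%:C%C.
have uE : rnorm u = (rnorm x)^-1 by rewrite rnorm_real ger0_norm// invr_ge0 ltW.
have : rnorm (l (u *: x)) <= 1.
  rewrite -lee_fin; apply: le_trans l1; apply: ereal_sup_ubound.
  by exists (u *: x) => //=; rewrite rnormZ uE mulVf// gt_eqF.
by rewrite linearZ rnormM uE ler_pdivrMl// mulr1.
Qed.

(** A functional in the dual ball acts on lifted families through its values [w] at the lifted unit
    vectors. By finite duality [w] has l^p-norm at most 1, so the hypothesis at [w] is the required
    bound. *)
Lemma weak1norm_lift_le1 (p q : \bar R) (p1 : (1 <= p)%E) (q1 : (1 <= q)%E) (n : nat)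
    (K : finType) (l : 'I_n -> K -> R[i]) (c : nat -> option K)
    (hc : lift_contractive q c) :
  (p^-1 + q^-1 = 1)%E -> p != 1%E ->
  (forall w : K -> R[i], \sum_i rnorm (\sum_k l i k * w k) <= fine (lpnorm p w)) ->
  (weak1norm (fun i => lift_lp q1 hc (l i)) <= 1)%E.
Proof.
move=> pq pn1 lw; apply: ge_ereal_sup => _ [L hL <-]; rewrite lee_fin.
pose w k := L (lift_lp q1 hc (fun k' => (k' == k)%:R)).
have LE (u : K -> R[i]) : L (lift_lp q1 hc u) = \sum_k u k * w k.
  by rewrite -lift_lp_sum linear_sum; apply: eq_bigr => k _; rewrite linearZ.
under eq_bigr do rewrite LE.
apply: le_trans (lw w) (lpnorm_le1_dual p1 q1 pq pn1 _) => u.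
rewrite -LE; apply: le_trans (dual_ball_le _ hL) _.
by rewrite lp_rnormE; apply: fine_lpnorm_le; [exact: lpnorm_ge0|exact: hc].
Qed.

Lemma cauchy_schwarz_sum (n : nat) (a : 'I_n -> R) : (forall i, 0 <= a i) ->
  \sum_i a i <= Num.sqrt (\sum_i a i ^+ 2) * Num.sqrt n%:R.
Proof.
move=> a0; have two0 : 0 < 2 :> R by [].
have half2 : 2^-1 + 2^-1 = 1 :> R by lra.
have := hoelder_sum two0 two0 half2 a0 (fun=> ler01).
rewrite !powR12_sqrt; try by apply: sumr_ge0 => i _; exact: powR_ge0.
under eq_bigr do rewrite mulr1.
move=> /le_trans; apply; rewrite le_eqVlt; apply/orP; left; apply/eqP.
congr (Num.sqrt _ * Num.sqrt _).
  by apply: eq_bigr => i _; rewrite powR_mulrn.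
by under eq_bigr do rewrite powR1; rewrite sumr_const card_ord.
Qed.

Lemma phi_max_lp_le_orlicz (p q : \bar R) (p1 : (1 <= p)%E) (q1 : (1 <= q)%E) (n : nat) :
  (p^-1 + q^-1 = 1)%E -> (1 <= n)%N -> (2%:E <= p)%E ->
  (phi_max (lp nat p1) n <= orlicz_const (lp nat q1) * (Num.sqrt n%:R)%:E)%E.
Proof.
move=> pq n1 p2; apply: phi_max_le => N x NN x1.
have pn1 : p != 1%E by apply: contraTneq p2 => ->; rewrite lee_fin; lra.
(* [q] is finite because [p] is not 1; norms are then preserved by the lift along a partial
   bijection. *)
have [s [s1 qE]] : exists s : R, 1 <= s /\ q = s%:E.
  have [[r [s [_ -> _ s1 _]]]|[pE _]|[_ ->]] := conjugate_casesP p1 q1 pq.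
  - by exists s; rewrite ltW.
  - by move: pn1; rewrite pE eqxx.
  - by exists 1.
apply: (multinorm_lp_le n1 NN x1) => K l z lw z1.
(* An enumeration of [K] moves the finite families [l i] isometrically into l^q over [nat], where
   the Orlicz constant is taken. *)
pose c := @pickle_inv K.
have hc : lift_contractive q c.
  exact: (lift_partial_bij_contractive q1 pickleK_inv pickle_invK).
pose L i := lift_lp q1 hc (l i).
have LE i : rnorm (L i) = fine (lpnorm q (l i)).
  by rewrite lp_rnormE /= qE (lpnorm_lift _ s1 pickleK_inv pickle_invK).
apply: (@le_trans _ _ ((Num.sqrt (\sum_i rnorm (L i) ^+ 2))%:E * (Num.sqrt n%:R)%:E)%E).
  rewrite -EFinM lee_fin; apply: le_trans (cauchy_schwarz_sum (fun i => rnorm_ge0 (L i))).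
  apply: le_trans (rnorm_sum _ _ _) _; apply: ler_sum => i _; rewrite LE.
  apply: le_trans (hoelder_lpnorm _ _ q1 p1 _) _; first by rewrite addeC.
  by rewrite -[leRHS]mulr1 ler_wpM2l ?lpnorm_ge0.
apply: lee_wpmul2r; first by rewrite lee_fin sqrtr_ge0.
apply: ereal_sup_ubound; exists n, L; split => //.
exact: (weak1norm_lift_le1 p1 q1 hc pq pn1 lw).
Qed.

End UpperBounds.

(** * Finite maxima and extended tuples *)

Section FiniteSup.
Context {R : realType}.

(** The base value 0 is that of [multinormA2], whose bound therefore folds to [supn]. *)
Definition supn (k : nat) (f : 'I_k -> R) : R := \big[Num.max/0]_(i < k) f i.

Lemma supn_leP (k : nat) (f : 'I_k -> R) (c : R) : 0 <= c ->
  supn f <= c <-> forall i, f i <= c.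
Proof.
move=> c0; split=> [fc i|fc]; last exact: bigmax_le.
by apply: le_trans fc; exact: le_bigmax.
Qed.

Lemma supn_ge0 (k : nat) (f : 'I_k -> R) : 0 <= supn f.
Proof. exact: bigmax_ge_id. Qed.

Lemma le_supn (k : nat) (f : 'I_k -> R) i : f i <= supn f.
Proof. exact: le_bigmax. Qed.

Lemma supn1 (f : 'I_1 -> R) : 0 <= f ord0 -> supn f = f ord0.
Proof.
move=> f0; apply/le_anti; rewrite le_supn andbT.
by apply/supn_leP => // i; rewrite ord1.
Qed.

Lemma supn_perm (k : nat) (s : 'S_k) (f : 'I_k -> R) : supn (fun i => f (s i)) = supn f.
Proof.
apply/le_anti/andP; split; apply/supn_leP; rewrite ?supn_ge0// => i.
  exact: (le_supn f (s i)).
have -> : f i = f (s ((s^-1)%g i)) by rewrite permKV.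
exact: (le_supn (fun i => f (s i))).
Qed.

Lemma supnM_le (k : nat) (f g : 'I_k -> R) :
  (forall i, 0 <= f i) -> (forall i, 0 <= g i) ->
  supn (fun i => f i * g i) <= supn f * supn g.
Proof.
move=> f0 g0; apply/supn_leP; first by rewrite mulr_ge0 ?supn_ge0.
by move=> i; rewrite ler_pM// le_supn.
Qed.

Lemma supnZ (k : nat) (c : R) (f : 'I_k -> R) : 0 <= c ->
  supn (fun i => c * f i) = c * supn f.
Proof.
move=> c0; apply/le_anti/andP; split.
  apply/supn_leP; first by rewrite mulr_ge0 ?supn_ge0.
  by move=> i; rewrite ler_wpM2l// le_supn.
have [->|cn0] := eqVneq c 0; first by rewrite mul0r supn_ge0.
have cgt : 0 < c by rewrite lt_neqAle eq_sym cn0.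
rewrite -ler_pdivlMl//; apply/supn_leP => [|i].
  by rewrite mulr_ge0 ?supn_ge0// invr_ge0.
by rewrite ler_pdivlMl//; exact: (le_supn (fun i => c * f i)).
Qed.

Lemma supnD_le (k : nat) (f g h : 'I_k -> R) : (forall i, h i <= f i + g i) ->
  supn h <= supn f + supn g.
Proof.
move=> hfg; apply/supn_leP; first by rewrite addr_ge0 ?supn_ge0.
by move=> i; apply: le_trans (hfg i) _; apply: lerD; exact: le_supn.
Qed.

Lemma fsnoc_widen (E : Type) (k : nat) (x : 'I_k -> E) (y : E) (i : 'I_k) :
  fsnoc x y (lift ord_max i) = x i.
Proof. by rewrite /fsnoc liftK. Qed.

Lemma comp_fsnoc (E F : Type) (k : nat) (g : E -> F) (x : 'I_k -> E) (y : E) :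
  (fun i => g (fsnoc x y i)) = fsnoc (fun i => g (x i)) (g y).
Proof. by apply/funext => i; rewrite /fsnoc; case: unlift. Qed.

(** Serves both (A3), where [c] is 0, and (A4), where [c] repeats the last entry. *)
Lemma supn_fsnoc (k : nat) (f : 'I_k -> R) (c : R) : c <= supn f ->
  supn (fsnoc f c) = supn f.
Proof.
move=> cf; apply/le_anti/andP; split; apply/supn_leP; rewrite ?supn_ge0// => i.
  by rewrite /fsnoc; case: unliftP => [j _|_] //=; exact: le_supn.
by rewrite -(fsnoc_widen f c i) le_supn.
Qed.

End FiniteSup.

(** * Multi-norms pulled back along a contraction *)

Section Pullback.
Context {R : realType} {E F : normedModType R[i]} (P : E -> F).
Hypothesis PD : forall x y, P (x + y) = P x + P y.
Hypothesis PZ : forall (a : R[i]) x, P (a *: x) = a *: P x.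
Hypothesis P_contractive : forall x, rnorm (P x) <= rnorm x.
Context {N : forall k : nat, ('I_k -> F) -> R}.
Hypothesis multiN : is_multinorm N.

(** The maximum of the norms restores definiteness where [P] has a kernel, and the norm of [E] at
    [k = 1], since [P] is a contraction. *)
Definition pullback_multinorm (k : nat) (x : 'I_k -> E) : R :=
  Num.max (supn (fun i => rnorm (x i))) (N (fun i => P (x i))).

Lemma is_multinorm_pullback : is_multinorm pullback_multinorm.
Proof.
have P0 : P 0 = 0 by rewrite -(scale0r (0 : E)) PZ scale0r.
have rx0 (x : E) : 0 <= rnorm x by exact: rnorm_ge0.
have max0 k (x : 'I_k -> E) : 0 <= pullback_multinorm x by rewrite le_max supn_ge0.
split.
- move=> k k1; have [N0 _ NZ ND] := multinorm_norm multiN k1; split=> //.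
  + move=> x x0; apply/funext => i; apply: rnorm_eq0; apply/le_anti.
    rewrite rx0 andbT -x0; apply: le_trans (le_supn (fun j => rnorm (x j)) i) _.
    by rewrite le_max lexx.
  + move=> a x; rewrite /pullback_multinorm [RHS]maxr_pMr ?rnorm_ge0// -NZ -supnZ ?rnorm_ge0//.
    congr Num.max; [congr (supn _) | congr (N _)]; apply/funext => i.
      exact: rnormZ.
    exact: PZ.
  + move=> x y; rewrite /pullback_multinorm ge_max; apply/andP; split.
      apply: (@le_trans _ _
        (supn (fun i => rnorm (x i)) + supn (fun i => rnorm (y i)))).
        by apply: supnD_le => i; exact: rnormD.
      by apply: lerD; rewrite le_max lexx.
    rewrite (_ : (fun i => P _) = (fun i => P (x i)) + (fun i => P (y i))).
      by apply: le_trans (ND _ _) _; apply: lerD; rewrite le_max lexx orbT.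
    by apply/funext => i; rewrite PD.
- move=> x; rewrite /pullback_multinorm (multinorm1 multiN) supn1//.
  by apply/max_l; exact: P_contractive.
- move=> k s x k2; rewrite /pullback_multinorm (supn_perm s (fun i => rnorm (x i))).
  by rewrite (multinormA1 multiN s (fun i => P (x i)) k2).
- move=> k a x k2; rewrite /pullback_multinorm -/(supn _) maxr_pMr ?supn_ge0//.
  rewrite ge_max !le_max; apply/andP; split; apply/orP; [left|right].
    under [X in supn X <= _]eq_fun do rewrite rnormZ.
    apply: (supnM_le (f := fun i => rnorm (a i)) (g := fun i => rnorm (x i))) => i;
      exact: rnorm_ge0.
  under [X in N X <= _]eq_fun do rewrite PZ.
  exact: (multinormA2 multiN).
- move=> k x; rewrite /pullback_multinorm !comp_fsnoc P0 rnorm0 (multinormA3 multiN).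
  by rewrite supn_fsnoc ?supn_ge0.
- move=> k x; rewrite /pullback_multinorm !comp_fsnoc.
  rewrite (multinormA4 multiN (fun i => P (x i))).
  by rewrite supn_fsnoc// (le_supn (fun i => rnorm (x i))).
Qed.

Lemma pullback_le_phi_max (n : nat) (x : 'I_n -> E) : (forall i, rnorm (x i) <= 1) ->
  ((N (fun i => P (x i)))%:E <= phi_max E n)%E.
Proof.
move=> x1; apply: le_trans (le_phi_max is_multinorm_pullback x1).
by rewrite lee_fin le_max lexx orbT.
Qed.

End Pullback.

(** * The lattice multi-norm on a finite l^p *)

Section LatticeMultinorm.
Context {R : realType} {K : finType} {p : \bar R} (p1 : (1 <= p)%E).

Lemma lp_of_fin_subproof (x : K -> R[i]) : x \in finite_lpnorm p1.
Proof. by rewrite inE /=; exact: lpnorm_fintype. Qed.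

Definition lp_of_fin (x : K -> R[i]) : lp K p1 := Lp (lp_of_fin_subproof x).

Lemma lpnorm_fin_mono (x y : K -> R[i]) : (forall k, rnorm (x k) <= rnorm (y k)) ->
  fine (lpnorm p x) <= fine (lpnorm p y).
Proof.
move=> xy; have y0 := lpnorm_ge0 y p1.
rewrite -(lpnorm_fin_le _ p1 y0) (lpnorm_finP _ p1 y0).
have := lpnorm_le_fine (lpnorm_fintype y p1); rewrite (lpnorm_finP _ p1 y0).
have : (1 <= p)%E by exact: p1.
case: (p) => [r| |] // r1; last first.
  by move=> /asboolP hy; apply/asboolP => k; apply: le_trans (xy k) (hy k).
apply: le_trans; apply: le_esum => k _; rewrite lee_fin le_powR ?rnorm_ge0//.
by rewrite lee_fin in r1; exact: le_trans r1.
Qed.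

Definition lattice_multinorm (k : nat) (x : 'I_k -> lp K p1) : R :=
  rnorm (lp_of_fin (fun j => (supn (fun i => rnorm (x i j)))%:C%C)).

Lemma rnorm_real_ge0 (t : R) : 0 <= t -> rnorm t%:C%C = t.
Proof. by move=> t0; rewrite rnorm_real ger0_norm. Qed.

Lemma lattice_multinorm_le (k : nat) (x : 'I_k -> lp K p1) (y : lp K p1) :
  (forall j, supn (fun i => rnorm (x i j)) <= rnorm (y j)) ->
  lattice_multinorm x <= rnorm y.
Proof.
by move=> xy; apply: lpnorm_fin_mono => j; rewrite rnorm_real_ge0 ?supn_ge0.
Qed.

Lemma eq_lattice_multinorm (k l : nat) (x : 'I_k -> lp K p1) (y : 'I_l -> lp K p1) :
  (forall j, supn (fun i => rnorm (x i j)) = supn (fun i => rnorm (y i j))) ->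
  lattice_multinorm x = lattice_multinorm y.
Proof.
by move=> xy; congr (rnorm (lp_of_fin _)); apply/funext => j; rewrite xy.
Qed.

(** The l^p-norm is monotone in the moduli, so each axiom reduces to a coordinatewise fact about
    [supn]. *)
Lemma is_multinorm_lattice : is_multinorm lattice_multinorm.
Proof.
have r0 (a : R[i]) : 0 <= rnorm a by exact: rnorm_ge0.
split.
- move=> k k1; split.
  + move=> x; exact: rnorm_ge0.
  + move=> x x0; apply/funext => i; apply/val_inj/funext => j; apply: rnorm_eq0.
    have /(congr1 (fun y : lp K p1 => y j)) /= := rnorm_eq0 x0.
    move=> /complexI s0; apply/le_anti; rewrite r0 andbT -[leRHS]s0.
    exact: (le_supn (fun i => rnorm (x i j))).
  + move=> a x; rewrite /lattice_multinorm -[rnorm a in RHS](rnorm_real_ge0 (r0 a)).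
    rewrite -rnormZ; congr rnorm; apply/val_inj/funext => j /=.
    rewrite -[RHS]/(_ * _) -rmorphM -supnZ//; congr ((supn _)%:C%C).
    by apply/funext => i; rewrite -rnormM.
  + move=> x y; apply: le_trans (rnormD _ _); apply: lattice_multinorm_le => j.
    rewrite -[X in rnorm X]/(_ + _) -rmorphD rnorm_real_ge0 ?addr_ge0 ?supn_ge0//.
    by apply: supnD_le => i; exact: rnormD.
- move=> x; apply/le_anti/andP; split.
    by apply: lattice_multinorm_le => j; rewrite supn1.
  apply: lpnorm_fin_mono => j; rewrite rnorm_real_ge0 ?supn_ge0//.
  by rewrite supn1.
- move=> k s x _; apply: eq_lattice_multinorm => j.
  exact: (supn_perm s (fun i => rnorm (x i j))).
- move=> k a x _; rewrite -/(supn _) -[supn _ in leRHS]rnorm_real_ge0 ?supn_ge0//.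
  rewrite -rnormZ; apply: lattice_multinorm_le => j.
  rewrite -[X in rnorm X]/(_ * _) -rmorphM rnorm_real_ge0 ?mulr_ge0 ?supn_ge0//.
  under eq_fun do rewrite -[X in rnorm X]/(_ * _) rnormM.
  exact: (supnM_le (f := fun i => rnorm (a i)) (g := fun i => rnorm (x i j))).
- move=> k x; apply: eq_lattice_multinorm => j.
  rewrite (comp_fsnoc (fun y : lp K p1 => rnorm (y j))) supn_fsnoc//.
  by rewrite [X in rnorm X](_ : _ = 0)// rnorm0 supn_ge0.
- move=> k x; apply: eq_lattice_multinorm => j.
  rewrite (comp_fsnoc (fun y : lp K p1 => rnorm (y j))) supn_fsnoc//.
  exact: (le_supn (fun i => rnorm (x i j))).
Qed.

End LatticeMultinorm.

(** The images [P (x i)] are the unit vectors; their coordinatewise maximum is constantly 1 and has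
    l^r-norm [n ^ (1/r)]. *)
Lemma lattice_le_phi_max (R : realType) (E : normedModType R[i]) (r : R)
    (r1 : (1 <= r%:E)%E) (n : nat) (P : E -> lp 'I_n r1) (x : 'I_n -> E) :
  (forall x y, P (x + y) = P x + P y) -> (forall (a : R[i]) x, P (a *: x) = a *: P x) ->
  (forall x, rnorm (P x) <= rnorm x) -> (forall i, rnorm (x i) <= 1) ->
  (forall i j, P (x i) j = (j == i)%:R) -> ((n%:R `^ r^-1)%:E <= phi_max E n)%E.
Proof.
move=> PD PZ Pc x1 xP.
apply: le_trans (pullback_le_phi_max PD PZ Pc (is_multinorm_lattice r1) x1).
rewrite lee_fin /lattice_multinorm lp_rnormE lpnorm_sumE -?lee_fin//.
apply: le_powR; rewrite ?ler0n// ?invr_ge0.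
  by rewrite -lee_fin; apply: le_trans (r1); rewrite lee_fin.
rewrite -[leLHS]mulr1 mulr_natl -[n in leLHS]card_ord -sumr_const.
apply: ler_sum => j _; rewrite rnorm_real_ge0 ?supn_ge0//.
rewrite -[leLHS](_ : 1 `^ r = 1); last by rewrite powR1.
apply: le_powR => //.
  by rewrite -lee_fin; apply: le_trans (r1); rewrite lee_fin.
apply: le_trans (le_supn _ j); rewrite xP eqxx /rnorm normr1//.
Qed.

(** * Comparison of the finite and the infinite sequence space *)

Lemma lpnorm_restrict_le (R : realType) (p : \bar R) (n : nat) (y : nat -> R[i]) (b : R) :
  (1 <= p)%E -> 0 <= b -> (lpnorm p y <= b%:E)%E ->
  (lpnorm p (fun k : 'I_n => y k) <= b%:E)%E.
Proof.
move=> p1 b0; rewrite !(lpnorm_finP _ p1 b0).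
case: p p1 => [r| |] // r1; last first.
  by move=> /asboolP hy; apply/asboolP => k; exact: hy.
rewrite lee_fin in r1; have r0 : r != 0 by rewrite gt_eqF//; lra.
pose c (j : nat) : option 'I_n := insub j.
have dK : pcancel (@nat_of_ord n) c by exact: valK.
have cK : ocancel c (@nat_of_ord n) by exact: insubK.
apply: le_trans; rewrite esum_finE; last by move=> k; exact: powR_ge0.
rewrite -(esum_lift _ r0 dK cK); apply: le_esum => j _; rewrite lee_fin.
rewrite /lift_family /c; case: insubP => [k _ <-|_] //=.
by rewrite rnorm0 powR0// powR_ge0.
Qed.

(** A multi-norm is pulled back along the restriction to the first [n] coordinates, a contraction
    for which extension by zero is a norm-preserving right inverse. *)
Lemma phi_max_lp_fin_le (R : realType) (p : \bar R) (p1 : (1 <= p)%E) (n : nat) :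
  (phi_max (lp 'I_n p1) n <= phi_max (lp nat p1) n)%E.
Proof.
apply: phi_max_le => N x NN x1.
pose c (j : nat) : option 'I_n := insub j.
have dK : pcancel (@nat_of_ord n) c by exact: valK.
have cK : ocancel c (@nat_of_ord n) by exact: insubK.
have hc := lift_partial_bij_contractive (R := R) p1 dK cK.
pose P (y : lp nat p1) : lp 'I_n p1 := lp_of_fin p1 (fun k : 'I_n => y k).
have Pc y : rnorm (P y) <= rnorm y.
  rewrite !lp_rnormE; have y0 := lpnorm_ge0 y p1; apply: fine_lpnorm_le => //.
  exact: lpnorm_restrict_le (lpnorm_le_fine (lp_finite y)).
have -> : x = (fun i => P (lift_lp p1 hc (x i))).
  apply/funext => i; apply/val_inj/funext => k /=.
  by rewrite /lift_family dK.
have PD y z : P (y + z) = P y + P z by exact/val_inj.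
have PZ (a : R[i]) y : P (a *: y) = a *: P y by exact/val_inj.
apply: (pullback_le_phi_max PD PZ Pc NN) => i.
apply: le_trans (x1 i); rewrite !lp_rnormE; apply: fine_lpnorm_le; last exact: hc.
exact: lpnorm_ge0.
Qed.

(** * The finite Fourier matrix *)

Section Fourier.
Context {R : realType}.

(** [X^n - 1] splits and is separable, and [n] distinct roots of unity of order dividing [n] include
    a primitive one. *)
Lemma complex_prim_root (n : nat) : (0 < n)%N -> exists w : R[i], n.-primitive_root w.
Proof.
move=> n0; pose f : {poly R[i]} := 'X^n - 1.
have [r Dr] := closed_field_poly_normal f.
rewrite (monicP _) ?monicXnsubC // scale1r in Dr.
have rn1 : all n.-unity_root r by apply/allP=> z; rewrite -root_prod_XsubC -Dr.
have sz_r : (n < (size r).+1)%N.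
  by rewrite -(size_prod_XsubC r id) -Dr size_XnsubC.
have [|z] := hasP (has_prim_root n0 rn1 _ sz_r); last by exists z.
by rewrite -separable_prod_XsubC -Dr separable_Xn_sub_1 // pnatr_eq0 -lt0n.
Qed.

Lemma rnormX (a : R[i]) (k : nat) : rnorm (a ^+ k) = rnorm a ^+ k.
Proof.
elim: k => [|k IH]; first by rewrite !expr0 /rnorm normr1.
by rewrite !exprS rnormM IH.
Qed.

Lemma mul_conj (a : R[i]) : a * a^* = (rnorm a ^+ 2)%:C%C.
Proof. by rewrite -normCK rnormE rmorphXn. Qed.

Lemma rnorm_conj (a : R[i]) : rnorm a^* = rnorm a.
Proof. by rewrite /rnorm norm_conjC. Qed.

Variables (n : nat) (w : R[i]).
Hypothesis w_prim : n.-primitive_root w.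

Let n0 : (0 < n)%N := prim_order_gt0 w_prim.

Lemma rnorm_prim_root (k : nat) : rnorm (w ^+ k) = 1.
Proof.
rewrite rnormX (_ : rnorm w = 1) ?expr1n//; apply/eqP.
rewrite -(@pexpr_eq1 _ _ n) ?rnorm_ge0// -rnormX (prim_expr_order w_prim).
by rewrite /rnorm normr1.
Qed.

(** A geometric sum whose ratio [z] satisfies [z ^ n = 1]; primitivity of [w] excludes [z = 1] when
    [i] and [j] differ. *)
Lemma fourier_orthogonal (i j : 'I_n) :
  \sum_(k < n) w ^+ (j * k) * (w ^+ (i * k))^* = n%:R * (j == i)%:R.
Proof.
have wc k : w ^+ k * (w ^+ k)^* = 1 by rewrite mul_conj rnorm_prim_root expr1n.
pose z := w ^+ j * (w ^+ i)^*.
have zE (k : 'I_n) : w ^+ (j * k) * (w ^+ (i * k))^* = z ^+ k.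
  by rewrite !exprM rmorphXn -exprMn.
under eq_bigr do rewrite zE.
have [ji|ji] := eqVneq j i.
  under eq_bigr do rewrite /z ji wc expr1n.
  by rewrite sumr_const card_ord mulr1.
have zn : z ^+ n = 1.
  rewrite /z exprMn -rmorphXn -!exprM !(mulnC _ n) !exprM (prim_expr_order w_prim).
  by rewrite !expr1n rmorph1 mulr1.
have /eqP : (z - 1) * \sum_(k < n) z ^+ k = 0 by rewrite -subrX1 zn subrr.
rewrite mulf_eq0 subr_eq0 => /orP[/eqP z1|/eqP -> //]; last by rewrite mulr0.
have : w ^+ j = w ^+ i.
  by rewrite -[LHS]mulr1 -(wc i) [w ^+ i * _]mulrC mulrA -/z z1 mul1r.
move/eqP; rewrite (eq_prim_root_expr w_prim) !modn_small// => /eqP /val_inj.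
by move/eqP; rewrite (negbTE ji).
Qed.

Lemma fourier_parseval (x : 'I_n -> R[i]) :
  \sum_(j < n) rnorm (\sum_(k < n) w ^+ (j * k) * x k) ^+ 2 = n%:R * \sum_k rnorm (x k) ^+ 2.
Proof.
apply: (@complexI R); rewrite rmorphM !rmorph_sum rmorph_nat.
transitivity (\sum_(j < n) \sum_(k < n)
    w ^+ (j * k) * x k * (\sum_(l < n) w ^+ (j * l) * x l)^*).
  by apply: eq_bigr => j _; rewrite -mulr_suml mul_conj.
rewrite exchange_big mulr_sumr; apply: eq_bigr => k _.
under eq_bigr do rewrite rmorph_sum mulr_sumr.
rewrite exchange_big/= (bigD1 k)//= [X in _ + X]big1 ?addr0 => [|l lk].
  transitivity (x k * (x k)^* * \sum_(j < n) w ^+ (k * j) * (w ^+ (k * j))^*).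
    rewrite mulr_sumr; apply: eq_bigr => j _.
    by rewrite rmorphM [(j * k)%N]mulnC mulrACA mulrC.
  by rewrite fourier_orthogonal eqxx mulr1 mulrC mul_conj.
transitivity (x k * (x l)^* * \sum_(j < n) w ^+ (k * j) * (w ^+ (l * j))^*).
  rewrite mulr_sumr; apply: eq_bigr => j _.
  by rewrite rmorphM (mulnC j k) (mulnC j l) mulrACA mulrC.
by rewrite fourier_orthogonal eq_sym (negbTE lk) !mulr0.
Qed.

End Fourier.

(** * Lower bounds for [phi_max] on the finite l^p *)

Section LowerBounds.
Context {R : realType}.

Lemma powR_le_phi_max (r : R) (r1 : (1 <= r%:E)%E) (n : nat) :
  ((n%:R `^ r^-1)%:E <= phi_max (lp 'I_n r1) n)%E.
Proof.
apply: (lattice_le_phi_max (P := id)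
  (x := fun i => lp_of_fin r1 (fun j => (j == i)%:R))) => // i.
rewrite lp_rnormE lpnorm_sumE -?lee_fin// (bigD1 i)//= eqxx big1 => [|j /negbTE ->].
  by rewrite addr0 /rnorm normr1 !powR1.
by rewrite rnorm0 powR0// gt_eqF// (lt_le_trans ltr01)// -lee_fin.
Qed.

(** The value at [+oo] is 0, so that exponents written with [rcp] cover the infinite case. *)
Definition rcp (p : \bar R) : R := fine (p^-1)%E.

(** For finite [p > 2] this is Hoelder for the squared moduli against the constant 1, with exponent
    [p / 2], followed by a square root; for [p = +oo] each modulus is bounded by the maximum. *)
Lemma l2norm_le (p : \bar R) (n : nat) (x : 'I_n -> R[i]) : (2%:E <= p)%E -> (1 <= n)%N ->
  n%:R `^ (rcp p - 2^-1) * fine (lpnorm 2%:E x) <= fine (lpnorm p x).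
Proof.
move=> p2 n1; have n0 : 0 < n%:R :> R by rewrite ltr0n.
rewrite lpnorm_sumE; last by lra.
case: p p2 => [r| |] // r2.
  rewrite lee_fin in r2; have r0 : r != 0 by rewrite gt_eqF//; lra.
  rewrite /rcp inver (negbTE r0)/= lpnorm_sumE; last by lra.
  have [->|rn2] := eqVneq r 2; first by rewrite subrr powRr0 mul1r.
  have r2' : 2 < r by rewrite lt_neqAle eq_sym rn2.
  pose s := (1 - 2 / r)^-1.
  have rr0 : 0 < r / 2 by lra.
  have si0 : 0 < 1 - 2 / r by rewrite subr_gt0 ltr_pdivrMr ?mul1r//; lra.
  have s0 : 0 < s by rewrite /s invr_gt0.
  have rs : (r / 2)^-1 + s^-1 = 1 by rewrite /s invrK invf_div; lra.
  have := hoelder_sum (b := fun=> 1) rr0 s0 rs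
    (fun k : 'I_n => powR_ge0 (rnorm (x k)) 2) (fun=> ler01).
  have -> : \sum_(k < n) rnorm (x k) `^ 2 * 1 = \sum_(k < n) rnorm (x k) `^ 2.
    by apply: eq_bigr => k _; rewrite mulr1.
  have -> : \sum_(k < n) (rnorm (x k) `^ 2) `^ (r / 2) = \sum_(k < n) rnorm (x k) `^ r.
    by apply: eq_bigr => k _; rewrite -powRrM mulrC divfK.
  have -> : \sum_(k < n) 1 `^ s = n%:R :> R.
    by under eq_bigr do rewrite powR1; rewrite sumr_const card_ord.
  set B := \sum_k _; set A := \sum_k _ => AB.
  have A0 : 0 <= A by apply: sumr_ge0 => k _; exact: powR_ge0.
  have B0 : 0 <= B by apply: sumr_ge0 => k _; exact: powR_ge0.
  have half0 : 0 <= 2^-1 :> R by lra.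
  have := le_powR half0 A0 AB; rewrite powRM ?powR_ge0// -!powRrM.
  have -> : (r / 2)^-1 * 2^-1 = r^-1 by rewrite invf_div mulrAC mulfV ?mul1r.
  have -> : s^-1 * 2^-1 = 2^-1 - r^-1.
    by rewrite /s invrK mulrBl mul1r mulrAC mulfV ?mul1r.
  move=> h; apply: le_trans (ler_wpM2l (powR_ge0 _ _) h) _.
  rewrite mulrCA -powRD; last by rewrite (gt_eqF n0) implybT.
  by rewrite (_ : _ - _ + _ = 0) ?powRr0 ?mulr1//; ring.
rewrite /rcp invey/= sub0r powRN -ler_pdivlMl ?invr_gt0 ?powR_gt0// invrK.
have M0 := lpnorm_ge0 x (leey 1).
have -> : fine (lpnorm +oo%E x) = (fine (lpnorm +oo%E x) `^ 2) `^ 2^-1.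
  by rewrite -powRrM mulfV ?pnatr_eq0// powRr1.
rewrite -powRM ?ler0n ?powR_ge0//; apply: le_powR; first by lra.
  by apply: sumr_ge0 => k _; exact: powR_ge0.
set M := fine _; rewrite -[leRHS](_ : \sum_(k < n) M `^ 2 = _); last first.
  by rewrite sumr_const card_ord mulr_natl.
apply: ler_sum => k _.
by apply: le_powR; rewrite ?rnorm_ge0 ?rnorm_le_lpnormy.
Qed.

Lemma lpnorm_flat_le1 (p : \bar R) (n : nat) (x : 'I_n -> R[i]) :
  (1 <= p)%E -> (1 <= n)%N -> (forall k, rnorm (x k) = n%:R `^ (- rcp p)) ->
  fine (lpnorm p x) <= 1.
Proof.
move=> p1 n1 xn; have n0 : 0 < n%:R :> R by rewrite ltr0n.
rewrite -(lpnorm_fin_le _ p1 ler01) (lpnorm_finP _ p1 ler01).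
case: p p1 xn => [r| |] // r1; last first.
  rewrite /rcp invey oppr0 powRr0 => xn.
  by apply/asboolP => k; rewrite xn.
rewrite lee_fin in r1; have r0 : r != 0 by rewrite gt_eqF//; lra.
rewrite /rcp inver (negbTE r0)/= => xn; rewrite esum_finE => [|k]; last exact: powR_ge0.
under eq_bigr do rewrite xn -powRrM mulNr mulVf// powR_inv1 ?ler0n//.
by rewrite sumr_const card_ord -[X in X%:E]mulr_natr mulVf ?gt_eqF// powR1.
Qed.

Lemma sqrt_le_phi_max (p : \bar R) (p1 : (1 <= p)%E) (n : nat) :
  (1 <= n)%N -> (2%:E <= p)%E -> ((Num.sqrt n%:R)%:E <= phi_max (lp 'I_n p1) n)%E.
Proof.
move=> n1 p2; have n0 : 0 < n%:R :> R by rewrite ltr0n.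
have nn0 : (n%:R : R) != 0 by rewrite gt_eqF.
have [w w_prim] := complex_prim_root (R := R) n1.
have two1 : (1 <= 2%:E :> \bar R)%E by rewrite lee_fin; lra.
(* The Fourier matrix multiplies the l^2-norm by [n ^ (1/2)], so the factor [t] leaves
   [n ^ (1/p - 1/2)], which [l2norm_le] absorbs: [P] is a contraction. *)
pose t : R := n%:R `^ (rcp p - 1).
have t0 : 0 <= t by exact: powR_ge0.
pose P (x : lp 'I_n p1) : lp 'I_n two1 :=
  lp_of_fin two1 (fun j : 'I_n => t%:C%C * \sum_(k < n) w ^+ (j * k) * x k).
(* Conjugate rows scaled to the l^p unit ball; by orthogonality [P] sends them to the unit vectors,
   since [t * n ^ (- 1/p) * n = 1]. *)
pose x (i : 'I_n) : lp 'I_n p1 :=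
  lp_of_fin p1 (fun k : 'I_n => (n%:R `^ (- rcp p))%:C%C * (w ^+ (i * k))^*).
rewrite -powR12_sqrt ?ler0n//.
apply: (@lattice_le_phi_max _ _ 2 two1 n P x).
- move=> y z; apply/val_inj/funext => j /=.
  rewrite -[RHS]/(_ + _) -mulrDr -big_split/=; congr (_ * _).
  by apply: eq_bigr => k _; rewrite -mulrDr.
- move=> a y; apply/val_inj/funext => j /=.
  rewrite -[RHS]/(_ * _) [RHS]mulrCA; congr (_ * _); rewrite mulr_sumr.
  by apply: eq_bigr => k _; rewrite [RHS]mulrCA.
- move=> y; apply: le_trans (l2norm_le _ p2 n1); rewrite lp_rnormE.
  rewrite !lpnorm_sumE; [|lra..].
  have sqE (u : 'I_n -> R[i]) : \sum_k rnorm (u k) `^ 2 = \sum_k rnorm (u k) ^+ 2.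
    by apply: eq_bigr => k _; rewrite powR_mulrn ?rnorm_ge0.
  rewrite !sqE /=.
  under eq_bigr do rewrite rnormM rnorm_real_ge0// exprMn.
  rewrite -mulr_sumr (fourier_parseval w_prim).
  have S0 : 0 <= \sum_k rnorm (y k) ^+ 2 by apply: sumr_ge0 => k _; exact: sqr_ge0.
  rewrite mulrA powRM ?mulr_ge0 ?sqr_ge0 ?ler0n//.
  rewrite le_eqVlt; apply/orP; left; apply/eqP; congr (_ * _).
  rewrite -[t ^+ 2]powR_mulrn// -powRrM -{2}[n%:R]powRr1 ?ler0n//.
  rewrite -powRD ?(gt_eqF n0) ?implybT// -powRrM; congr (_ `^ _); lra.
- move=> i; apply: lpnorm_flat_le1 => // k.
  by rewrite rnormM rnorm_conj (rnorm_prim_root w_prim) mulr1 rnorm_real_ge0 ?powR_ge0.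
- move=> i j /=.
  have -> : \sum_(k < n) w ^+ (j * k) * ((n%:R `^ (- rcp p))%:C%C * (w ^+ (i * k))^*) =
      (n%:R `^ (- rcp p))%:C%C * (n%:R * (j == i)%:R).
    rewrite -(fourier_orthogonal w_prim) mulr_sumr.
    by apply: eq_bigr => k _; rewrite mulrCA.
  rewrite !mulrA -rmorphM -powRD ?(gt_eqF n0) ?implybT//.
  rewrite (_ : _ - 1 + _ = -1); last by ring.
  rewrite powR_inv1 ?ler0n// -[n%:R : R[i]](rmorph_nat (real_complex R)) -rmorphM.
  by rewrite mulVf// rmorph1 mul1r.
Qed.

End LowerBounds.

Theorem theorem3p54 (R : realType) (p q : \bar R) (p1 : (1 <= p)%E)
    (q1 : (1 <= q)%E) (pq : (p^-1 + q^-1 = 1)%E) (n : nat) (n0 : (1 <= n)%N) :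
  ((p <= 2%:E)%E ->
     phi_max (lp nat p1) n = phi_max (lp 'I_n p1) n /\
     phi_max (lp 'I_n p1) n = (n%:R `^ (fine p)^-1)%:E) /\
  ((2%:E <= p)%E ->
     ((Num.sqrt n%:R)%:E <= phi_max (lp 'I_n p1) n)%E /\
     (phi_max (lp 'I_n p1) n <= phi_max (lp nat p1) n)%E /\
     (phi_max (lp nat p1) n <=
        orlicz_const (lp nat q1) * (Num.sqrt n%:R)%:E)%E).
Proof.
have monotone := phi_max_lp_fin_le p1 n.
split=> p2; last first.
  split; first exact: sqrt_le_phi_max.
  split=> //; exact: phi_max_lp_le_orlicz.
case: p p1 p2 monotone {pq} => [r| |] r1 //; rewrite lee_fin => r2 monotone.
have upper := phi_max_lp_le_powR r1 n0 r2.
have lower := powR_le_phi_max r1 n.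
(* The chain from [n ^ (1/r)] through the finite and the infinite space returns to [n ^ (1/r)], so
   all terms agree. *)
by split; apply/le_anti; rewrite ?monotone ?lower ?(le_trans upper lower)
  ?(le_trans monotone upper).
Qed.
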